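(* Let $K/F$ be Galois with $\mathrm{Gal}(K/F)=\langle\sigma\rangle\simeq G=\mathbb{Z}/p^n\mathbb{Z}$. Let $A$ be a finite $\mathbb{F}_p[G]$-module and $1\le\lambda<p^n$ such that $A\bullet_\lambda G$ is defined, and suppose $E$ solves the embedding problem $A\bullet_\lambda G\to G\to1$ over $K/F$. Let $M$ be a finite $\mathbb{F}_p[G]$-module having a cyclic direct summand of $\mathbb{F}_p$-dimension $\lambda$. Then the number of fields $L$ with $K\subseteq L\subseteq E$ solving $M\bullet_\lambda G\to G\to1$ over $K/F$ is $$\left[\binom{\Delta(A_{\{\lambda\}})-\Delta(M_{\{\lambda+1\}})}{\Delta(M_{\{\lambda\}})-\Delta(M_{\{\lambda+1\}})}_p-\binom{\Delta(A_{\{\lambda\}})-\Delta(M_{\{\lambda+1\}})-1}{\Delta(M_{\{\lambda\}})-\Delta(M_{\{\lambda+1\}})}_p\right]\prod_{i\ne\lambda}\binom{\Delta(A_{\{i\}})-\Delta(M_{\{i+1\}})}{\Delta(M_{\{i\}})-\Delta(M_{\{i+1\}})}_p\times\prod_{i=1}^{p^n}\left(\frac{p^{\sum_{j<i}\Delta(A_{\{j\}})}}{p^{\sum_{j<i}\Delta(M_{\{j\}})}}\right)^{\Delta(M_{\{i\}})-\Delta(M_{\{i+1\}})},$$ where $i$ ranges over $1,\dots,p^n$ in the products.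
   Context: For an $\mathbb{F}_p[G]$-module $V$ (additive), $V_{\{i\}}=(\sigma-1)^{i-1}V\cap V^G$ for $1\le i\le p^n+1$ and $\Delta(\cdot)=\dim_{\mathbb{F}_p}$. $\binom{N}{m}_p=\frac{(p^N-1)\cdots(p^{N-m+1}-1)}{(p^m-1)\cdots(p-1)}$ for $0\le m\le N$, $0$ otherwise. Groups: for a finite module $B=\bigoplus\mathbb{F}_p[G]\beta_i$ (a fixed decomposition into cyclic modules) and $\mu<p^n$ with some $\beta_{i_0}$ of dimension $\mu$, $B\bullet_\mu G$ is generated by $B$ and $\hat\sigma$ with the relations of $B$, $\hat\sigma b\hat\sigma^{-1}=\sigma b$, $\hat\sigma^{p^n}=(\sigma-1)^{\mu-1}\beta_{i_0}$; the map to $G$ kills $B$ and sends $\hat\sigma\mapsto\sigma$. A field $L\supseteq K$ Galois over $F$ solves $\varphi:\hat G\to G$ over $K/F$ if there is an isomorphism $\psi:\mathrm{Gal}(L/F)\to\hat G$ with $\varphi\circ\psi$ equal to restriction to $\mathrm{Gal}(K/F)=G$. *)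

(* Defs.v *)
From HB Require Import structures.
From mathcomp Require Import all_boot all_order all_algebra.
From mathcomp Require Import all_fingroup all_solvable all_field all_character.

Set Implicit Arguments.
Unset Strict Implicit.
Unset Printing Implicit Defensive.

Import Order.TTheory GRing.Theory Num.Theory.

Local Open Scope ring_scope.

(* The upper and lower arguments are integers because the upper one may be    *)
(* negative, in which case the value is 0 even when m = 0.                    *)
Definition gauss_binomial (p : nat) (N m : int) : rat :=
  if 0 <= m <= N then
    (\prod_(0 <= k < `|m|%N) (p%:R ^+ (`|N|%N - k) - 1)) /
    (\prod_(1 <= k < `|m|%N.+1) (p%:R ^+ k - 1))
  else 0.

(* A finite F_p[G]-module of dimension d is an mx_representation of G on      *)
(* row vectors 'rV['F_p]_d, an element g of G acting by b |-> b *m V g. As G  *)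
(* is abelian in what follows, left and right modules coincide.               *)

(* Delta V s i is the dimension of V_{i} = (s - 1)^(i-1) V :&: V^G, for i > 0. *)
Definition Delta (p : nat) (gT : finGroupType) (G : {group gT}) (d : nat)
    (V : mx_representation 'F_p G d) (s : gT) (i : nat) : nat :=
  \rank ((V s - 1%:M) ^+ i.-1 :&: rfix_mx V G)%MS.

Record cyclic_decomposition (p : nat) (gT : finGroupType) (G : {group gT})
    (d : nat) (B : mx_representation 'F_p G d) := CyclicDecomposition {
  cd_size : nat;
  cd_gen : 'I_cd_size -> 'rV['F_p]_d;
  cd_direct : mxdirect (\sum_i cyclic_mx B (cd_gen i));
  cd_full : (\sum_i cyclic_mx B (cd_gen i) :=: 1%:M)%MS
}.

(* Handedness: MathComp composes Galois automorphisms from left to right,     *)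
(* (x * y) a = y (x a), so 'Gal(L / F) is the opposite of the Galois group    *)
(* for the usual product. Everything is therefore transported to opposite     *)
(* groups: a relation t b t^-1 = s b of the usual convention reads            *)
(* t^-1 b t = s b, that is, iota b ^ t = iota (s b).                          *)

(* Data for an extension of a cyclic group of order N by 'rV['F_p]_d, with    *)
(* a lift t of the generator that acts by S and satisfies t ^ N = x.          *)
Record cyclic_ext (p d : nat) := CyclicExt {
  ce_ord : nat;
  ce_act : 'M['F_p]_d;
  ce_pow : 'rV['F_p]_d;
  ce_ord_gt1 : (1 < ce_ord)%N;
  ce_actX : ce_act ^+ ce_ord = 1;
  ce_powK : ce_pow *m ce_act = ce_pow
}.

(* The pair (i, b) stands for t ^ i * b.                                      *)
Definition ce_group (p d : nat) (D : cyclic_ext p d) : Type :=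
  ('I_(ce_ord D) * 'rV['F_p]_d)%type.

HB.instance Definition _ p d (D : cyclic_ext p d) := Finite.on (ce_group D).

Section CyclicExtGroup.

Variables (p d : nat) (D : cyclic_ext p d).
Local Notation N := (ce_ord D).
Local Notation S := (ce_act D).
Local Notation x := (ce_pow D).

Let N_gt0 : (0 < N)%N := ltnW (ce_ord_gt1 D).

Definition ce_ordinal (k : nat) : 'I_N := Ordinal (ltn_pmod k N_gt0).

Definition ce_mul (u v : ce_group D) : ce_group D :=
  (ce_ordinal (u.1 + v.1), u.2 *m S ^+ v.1 + v.2 + x *+ ((u.1 + v.1) %/ N)).

Definition ce_one : ce_group D := (ce_ordinal 0, 0).

Definition ce_inv (u : ce_group D) : ce_group D :=
  let j := ce_ordinal (N - u.1) in
  (j, - (u.2 + x *+ ((j + u.1) %/ N)) *m S ^+ j).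

Lemma ce_actX_mod k : S ^+ (k %% N) = S ^+ k.
Proof.
by rewrite [in RHS](divn_eq k N) exprD mulnC exprM ce_actX expr1n mul1r.
Qed.

Lemma ce_powX k : x *m S ^+ k = x.
Proof.
elim: k => [|k IHk]; first by rewrite expr0 mulmx1.
by rewrite exprSr mulmxA IHk ce_powK.
Qed.

Lemma ce_carry a k : ((a %% N + k) %/ N + a %/ N)%N = ((a + k) %/ N)%N.
Proof. by rewrite [in RHS](divn_eq a N) -addnA divnMDl // addnC. Qed.

Lemma ce_mulA : associative ce_mul.
Proof.
move=> [i b] [j c] [k e]; rewrite /ce_mul /=; congr (_, _).
  by apply: val_inj => /=; rewrite modnDmr modnDml addnA.
rewrite ce_actX_mod !mulmxDl -mulmxA exprD mulmxE -!addrA; congr (_ + (_ + _)).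
rewrite [RHS]addrCA; congr (_ + _).
have -> : (x *+ ((i + j) %/ N)) *m S ^+ k = x *+ ((i + j) %/ N).
  by have /= -> := raddfMn (mulmxr (S ^+ k)) ((i + j) %/ N) x; rewrite ce_powX.
rewrite -!mulrnDr; congr (_ *+ _).
rewrite [RHS]addnC ce_carry [(i + _ %% _)%N]addnC [LHS]addnC ce_carry.
by rewrite addnC addnA.
Qed.

Lemma ce_mul1 : left_id ce_one ce_mul.
Proof.
move=> [i b]; rewrite /ce_mul /= mod0n add0n mul0mx add0r.
rewrite divn_small ?ltn_ord // mulr0n addr0; congr (_, _).
by apply: val_inj; rewrite /= modn_small.
Qed.

Lemma ce_mulV : left_inverse ce_one ce_inv ce_mul.
Proof.
move=> [i b]; rewrite /ce_mul /ce_inv /=; congr (_, _).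
  by apply: val_inj => /=; rewrite modnDml subnK ?modnn ?mod0n // ltnW.
rewrite -mulmxA mulmxE -exprD -(ce_actX_mod (_ + i)) modnDml subnK;
  last exact: ltnW.
by rewrite modnn expr0 mulmx1 -addrA addNr.
Qed.

HB.instance Definition _ :=
  Finite_isGroup.Build (ce_group D) ce_mulA ce_mul1 ce_mulV.

Definition ce_iota (b : 'rV['F_p]_d) : ce_group D := (ce_ordinal 0, b).
Definition ce_lift : ce_group D := (ce_ordinal 1, 0).

End CyclicExtGroup.

Section CyclicExtPresentation.

Variables (p d : nat) (D : cyclic_ext p d).
Local Notation N := (ce_ord D).
Local Notation S := (ce_act D).
Local Notation x := (ce_pow D).
Local Notation t := (ce_lift D).
Local Notation iota := (ce_iota D).

Let N_gt0 : (0 < N)%N := ltnW (ce_ord_gt1 D).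

Lemma ce_eq (u v : ce_group D) : u.1 = v.1 :> nat -> u.2 = v.2 -> u = v.
Proof. by case: u v => [i b] [j c] /= /val_inj -> ->. Qed.

Lemma ce_mulE (u v : ce_group D) : (u * v)%g =
  (ce_ordinal D (u.1 + v.1), u.2 *m S ^+ v.1 + v.2 + x *+ ((u.1 + v.1) %/ N)).
Proof. by []. Qed.

Lemma ce_iotaD : {morph iota : b c / b + c >-> (b * c)%g}.
Proof.
move=> b c; rewrite ce_mulE; apply: ce_eq; first by rewrite /= !(mod0n, addn0).
by rewrite /= !(mod0n, addn0) expr0 mulmx1 div0n addr0.
Qed.

Lemma ce_liftX k : (k < N)%N -> (t ^+ k)%g = (ce_ordinal D k, 0).
Proof.
elim: k => [|k IHk] ltkN //; rewrite expgSr IHk ?(ltnW ltkN) // ce_mulE.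
apply: ce_eq; first by rewrite /= modnDm addn1.
rewrite /= !modn_small ?(ltnW ltkN) ?ce_ord_gt1 //.
by rewrite addn1 divn_small // mul0mx !addr0.
Qed.

Lemma ce_normal_form (u : ce_group D) : u = (t ^+ u.1 * iota u.2)%g.
Proof.
case: u => i b; rewrite ce_liftX ?ltn_ord // ce_mulE; apply: ce_eq.
  by rewrite /= mod0n addn0 !modn_small.
rewrite /= mod0n addn0 (modn_small (ltn_ord i)) divn_small //.
by rewrite mul0mx add0r addr0.
Qed.

Lemma ce_conj b : (iota b ^ t)%g = iota (b *m S).
Proof.
apply: (canLR (mulKg _)); rewrite !ce_mulE; apply: ce_eq.
  by rewrite /= mod0n addnC.
rewrite /= mod0n (modn_small (ce_ord_gt1 D)) expr1 mul0mx !addr0 add0r.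
by rewrite divn_small ?ce_ord_gt1 // !addr0.
Qed.

Lemma ce_lift_pow : (t ^+ N)%g = iota x.
Proof.
have N1 := ce_ord_gt1 D; have ltN : (N.-1 < N)%N by rewrite prednK.
rewrite -(prednK N_gt0) expgSr ce_liftX // ce_mulE; apply: ce_eq.
  by rewrite /= modnDm addn1 prednK // modnn mod0n.
rewrite /= (modn_small N1) (modn_small ltN) addn1 prednK // divnn N_gt0.
by rewrite mul0mx !add0r.
Qed.

(* The group is presented by the relations of its abelian subgroup, the       *)
(* conjugation relation and the power relation.                               *)
Theorem ce_presentation (H : groupType) (j : 'rV['F_p]_d -> H) (h : H) :
    {morph j : b c / b + c >-> (b * c)%g} ->
    (forall b, (h^-1 * j b * h)%g = j (b *m S)) -> (h ^+ N)%g = j x ->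
  let extends (f : ce_group D -> H) :=
    [/\ {morph f : u v / (u * v)%g}, forall b, f (iota b) = j b & f t = h] in
  exists2 f, extends f & forall f', extends f' -> f' =1 f.
Proof.
move=> jD jS hN extends.
have j0 : j 0 = 1%g by apply: (mulgI (j 0)); rewrite -jD addr0 mulg1.
have jSX k b : (j b * h ^+ k)%g = (h ^+ k * j (b *m S ^+ k))%g.
  elim: k b => [|k IHk] b; first by rewrite !expg0 expr0 mulmx1 mulg1 mul1g.
  rewrite expgSr mulgA IHk -!mulgA; congr (_ * _)%g.
  by rewrite exprSr mulmxA -jS !mulgA mulgV mul1g.
have jMn b k : j (b *+ k) = (j b ^+ k)%g.
  by elim: k => [|k IHk]; rewrite ?mulr0n ?expg0 // mulrS expgS jD IHk.
have hX k : (h ^+ k)%g = (h ^+ (k %% N) * j (x *+ (k %/ N)))%g.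
  by rewrite [in LHS](divn_eq k N) addnC expgD mulnC expgM hN jMn.
exists (fun u : ce_group D => h ^+ u.1 * j u.2)%g.
  split=> [u v|b|]; last 2 first.
  - by rewrite /= mod0n expg0 mul1g.
  - by rewrite /= (modn_small (ce_ord_gt1 D)) expg1 j0 mulg1.
  rewrite ce_mulE /= !jD -!mulgA [(j u.2 * _)%g]mulgA jSX -!mulgA !mulgA -expgD.
  rewrite (hX (u.1 + v.1)%N) -!mulgA; congr (_ * _)%g.
  by rewrite -!jD addrA addrC.
move=> f [fM fj ft] u; rewrite {1}(ce_normal_form u) fM fj; congr (_ * _)%g.
have f1 : f 1%g = 1%g by apply: (mulgI (f 1%g)); rewrite -fM !mulg1.
elim: (u.1 : nat) => [|k IHk]; first by rewrite !expg0.
by rewrite !expgSr fM IHk ft.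
Qed.

End CyclicExtPresentation.

Lemma unipotent_nilp (p n d : nat) (S : 'M['F_p]_d) :
  prime p -> S ^+ (p ^ n) = 1 -> (S - 1%:M) ^+ (p ^ n) = 0.
Proof.
move=> p_pr; case: d S => [|d'] S; first by move=> _; rewrite flatmx0 [RHS]flatmx0.
have pM : p \in [pchar 'M['F_p]_d'.+1] by rewrite pchar_lalg pchar_Fp.
have /(_ n) -> k : (S - 1) ^+ (p ^ k) = S ^+ (p ^ k) - 1.
  elim: k => [|k IHk]; first by rewrite !expr1.
  rewrite expnSr !exprM IHk -!(pFrobenius_autE pM) pFrobenius_autB_comm.
    by rewrite pFrobenius_aut1.
  exact/commr1.
by move=> ->; rewrite subrr.
Qed.

Section Bullet.

Variables (p n : nat) (gT : finGroupType) (G : {group gT}) (s : gT).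
Variables (d : nat) (B : mx_representation 'F_p G d) (mu : nat).
Hypotheses (p_pr : prime p) (defG : G :=: <[s]>%g) (oG : #|G| = (p ^ n)%N).
Hypothesis (mu_bounds : (0 < mu < p ^ n)%N).
Variables (dB : cyclic_decomposition B) (i0 : 'I_(cd_size dB)).
Hypothesis dim_i0 : \rank (cyclic_mx B (cd_gen i0)) = mu.

Definition bullet_pow : 'rV['F_p]_d :=
  cd_gen i0 *m (B s - 1%:M) ^+ mu.-1.

Let Gs : s \in G. Proof. by rewrite defG cycle_id. Qed.

Let os : #[s]%g = (p ^ n)%N. Proof. by rewrite orderE -defG oG. Qed.

Lemma bullet_ord_gt1 : (1 < p ^ n)%N.
Proof. by case/andP: mu_bounds => mu0; apply: leq_ltn_trans. Qed.

Lemma bullet_actX : B s ^+ (p ^ n) = 1.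
Proof.
have BX k : B s ^+ k = B (s ^+ k)%g.
  elim: k => [|k IHk]; first by rewrite repr_mx1.
  by rewrite exprSr expgSr IHk repr_mxM ?groupX.
by rewrite BX -os expg_order repr_mx1.
Qed.

Lemma bullet_powK : bullet_pow *m B s = bullet_pow.
Proof.
case/andP: mu_bounds => mu_gt0 _.
pose T := B s - 1%:M; pose W := cyclic_mx B (cd_gen i0).
have sW k : (W *m T ^+ k.+1 <= W *m T ^+ k)%MS.
  rewrite exprS mulmxA; apply: submxMr.
  rewrite mulmxBr mulmx1 addmx_sub ?eqmx_opp //.
  exact: (mxmoduleP (cyclic_mx_module B _)).
have rW k : (\rank (W *m T ^+ k) <= mu - k)%N.
  elim: k => [|k IHk]; first by rewrite expr0 mulmx1 subn0 dim_i0.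
  have [W0 | nzW] := eqVneq (W *m T ^+ k) 0.
    by rewrite exprSr mulmxA W0 mul0mx mxrank0.
  suff lt : (\rank (W *m T ^+ k.+1) < \rank (W *m T ^+ k))%N.
    by rewrite subnS; case: (mu - k)%N (leq_trans lt IHk).
  rewrite (ltn_leqif (mxrank_leqif_sup (sW k))); apply: contra nzW => sWk.
  have sWj j : (W *m T ^+ k <= W *m T ^+ (k + j))%MS.
    elim: j => [|j IHj]; first by rewrite addn0.
    apply: submx_trans sWk _; rewrite addnS !exprSr !mulmxA.
    exact: submxMr.
  have := sWj (p ^ n)%N; rewrite exprD (unipotent_nilp p_pr bullet_actX) mulr0 mulmx0.
  by rewrite submx0.
apply/eqP; rewrite -subr_eq0 -[X in _ - X]mulmx1 -mulmxBr /bullet_pow.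
rewrite -mulmxA -/T mulmxE -exprSr prednK // -submx0.
have /submx_trans -> // : (cd_gen i0 *m T ^+ mu <= W *m T ^+ mu)%MS.
  by rewrite submxMr ?cyclic_mx_id.
by rewrite submx0 -mxrank_eq0 -leqn0 -(subnn mu) rW.
Qed.

(* The group B \bullet_mu G is ce_group bullet, with \hat\sigma = ce_lift.    *)
(* Its defining presentation is given by ce_iotaD, ce_conj, ce_lift_pow and   *)
(* ce_presentation.                                                           *)
Definition bullet : cyclic_ext p d :=
  CyclicExt bullet_ord_gt1 bullet_actX bullet_powK.

Definition bullet_proj (u : ce_group bullet) : gT := (s ^+ u.1)%g.

Lemma bullet_projM :
  {in [set: ce_group bullet] &, {morph bullet_proj : u v / (u * v)%g}}.
Proof.
move=> [i b] [j c] _ _; rewrite /bullet_proj /= -expgD.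
by rewrite -[X in (_ %% X)%N]os expg_mod_order.
Qed.

Canonical bullet_proj_morphism := Morphism bullet_projM.

Lemma bullet_proj_iota b : bullet_proj (ce_iota bullet b) = 1%g.
Proof. by rewrite /bullet_proj /= mod0n. Qed.

Lemma bullet_proj_lift : bullet_proj (ce_lift bullet) = s.
Proof. by rewrite /bullet_proj /= modn_small ?expg1 ?bullet_ord_gt1. Qed.

End Bullet.

Definition solves (F0 : fieldType) (Om : splittingFieldType F0)
    (F K : {subfield Om}) (hT : finGroupType) (H : {group hT})
    (phi : {morphism H >-> gal_of K}) (L : {subfield Om}) : Prop :=
  [/\ (K <= L)%VS, galois F L &
      exists2 psi : {morphism 'Gal(L / F)%g >-> hT},
        isom 'Gal(L / F)%g H psi &
        forall x, x \in 'Gal(L / F)%g -> {in K, phi (psi x) =1 x}].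

(* Main.v *)
Require Import Defs.
From HB Require Import structures.
From mathcomp Require Import all_boot all_order all_algebra.
From mathcomp Require Import all_fingroup all_solvable all_field all_character.
From mathcomp Require Import ring.

Set Implicit Arguments.
Unset Strict Implicit.
Unset Printing Implicit Defensive.

Import Order.TTheory GRing.Theory Num.Theory.

Local Open Scope ring_scope.

(** By Galois theory, the fields L between K and E that are Galois over F
correspond to the submodules U of A, and Gal(L/F) is the extension of G by A/U in which the lift of sigma has power the image of xA. It is isomorphic
to the bullet group of M over G iff there is a surjective intertwiner X : A -> M
with kernel U mapping xA to xM up to (sigma - 1)^(p^n - 1) M. Automorphisms of M
act transitively on the fixed vectors lying in (sigma - 1)^(lambda - 1) M but not
in (sigma - 1)^lambda M, so this only says that xA X is not in
(sigma - 1)^lambda M. Hence the number of U is the number of such X divided by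
#|Aut M|.

Dually (that is, looking at the columns of X), an intertwiner is a choice, for
each Jordan block of M of size k_i, of a vector w_i killed by T^(k_i), where T is
the transpose of sigma - 1 on A; it is onto iff the vectors T^(k_i - 1) w_i are
linearly independent. With the blocks in order of decreasing size, these vectors
lie in an increasing chain of subspaces, so they are counted one after the other;
the height condition on xA is removed by subtracting the choices for which the
vectors of the blocks of size lambda lie in a fixed hyperplane. *)

(** * Counting tuples of vectors with independent images *)

Lemma row_free_col_mx (F : fieldType) (r e : nat) (V : 'M[F]_(r, e)) (v : 'rV_e) :
  row_free (col_mx V v) = row_free V && ~~ (v <= V)%MS.
Proof.
rewrite /row_free -addsmxE.
have le_r : (\rank V <= r)%N by apply: rank_leq_row.
have [sv|nsv] /= := boolP (v <= V)%MS.
  by rewrite andbF addsmxC (addsmx_idPr sv); apply/ltn_eqF; rewrite addn1 ltnS.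
have lt : (\rank V < \rank (V + v)%MS)%N.
  rewrite (ltn_leqif (mxrank_leqif_sup (addsmxSl V v))).
  by apply: contra nsv; apply: submx_trans; apply: addsmxSr.
have le : (\rank (V + v)%MS <= (\rank V).+1)%N.
  apply: leq_trans (mxrank_adds_leqif _ _) _.
  by rewrite -[X in (_ <= X)%N]addn1 leq_add2l rank_leq_row.
have -> : \rank (V + v)%MS = (\rank V).+1 by apply/eqP; rewrite eqn_leq le.
by rewrite andbT addn1 eqSS.
Qed.

Section CountingFreeImages.

Variables (F : finFieldType) (e : nat) (Z D : nat -> 'M[F]_e).

(** In use, [D i] sends a candidate generator of the i-th block to its last vector, and [Z i] is the
    space of admissible candidates. *)
Definition free_images (r : nat) : {set 'M[F]_(r, e)} :=
  [set W | row_free (\matrix_(i < r) (row i W *m D i))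
           & [forall i : 'I_r, (row i W <= Z i)%MS]].

(** [kermx (B *m cokermx V)] is the preimage of [V] under [B]. It meets [A] in a space that [B] maps
    onto [V] with the same kernel as on [A], so rank-nullity applies. *)
Lemma rank_preim_image (r : nat) (A B : 'M[F]_e) (V : 'M[F]_(r, e)) :
  (V <= A *m B)%MS ->
  \rank (A :&: kermx (B *m cokermx V))%MS = (\rank V + \rank (A :&: kermx B))%N.
Proof.
move=> sV; set A' := (A :&: _)%MS.
have sub m (w : 'M_(m, e)) : (w <= A')%MS = (w <= A)%MS && (w *m B <= V)%MS.
  by rewrite sub_capmx sub_kermx mulmxA [(_ *m B <= V)%MS]submxE.
have eqV : (A' *m B :=: V)%MS.
  apply/eqmxP/andP; split; first by have := sub _ A'; rewrite submx_refl => /esym/andP[].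
  have /submxP[w defV] := sV.
  have sw : (w *m A <= A')%MS by rewrite sub submxMl -mulmxA -defV submx_refl.
  by apply: submx_trans (submxMr B sw); rewrite -mulmxA -defV.
rewrite -(mxrank_mul_ker A' B) eqV; congr (_ + _)%N.
apply: eqmx_rank; apply/andP; split.
  by rewrite sub_capmx capmxSr (submx_trans (capmxSl _ _)) ?capmxSl.
rewrite sub_capmx capmxSr sub capmxSl /=.
by rewrite (sub_kermxP (capmxSr A (kermx B))) sub0mx.
Qed.

Lemma card_preim_notin (r : nat) (A B : 'M[F]_e) (V : 'M[F]_(r, e)) :
  (V <= A *m B)%MS -> row_free V ->
  #|[set w : 'rV_e | (w <= A)%MS && ~~ (w *m B <= V)%MS]|%:R
  = #|F|%:R ^+ \rank (A :&: kermx B)%MS * (#|F|%:R ^+ \rank (A *m B) - #|F|%:R ^+ r)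
  :> rat.
Proof.
move=> sV freeV.
have -> : [set w : 'rV_e | (w <= A)%MS && ~~ (w *m B <= V)%MS]
        = rowg A :\: rowg (A :&: kermx (B *m cokermx V))%MS.
  apply/setP=> w; rewrite !inE sub_capmx sub_kermx mulmxA.
  rewrite [(_ *m B <= V)%MS]submxE.
  by case: (w <= A)%MS; rewrite ?andbF ?andbT.
have sub : rowg (A :&: kermx (B *m cokermx V))%MS \subset rowg A.
  by apply/subsetP=> w; rewrite !mem_rowg => /submx_trans -> //; apply: capmxSl.
rewrite cardsD (setIidPr sub) natrB ?subset_leq_card // !card_rowg !natrX.
rewrite rank_preim_image // (eqP freeV) -(mxrank_mul_ker A B) !exprD mulrBr.
by rewrite mulrC [X in _ - X]mulrC.
Qed.

(** Rows are chosen one at a time. As the images [Z i *m D i] increase, the span of the earlier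
    images lies in the next one, so the number of choices for the next row does not depend on the
    previous choices. *)
Lemma card_free_images (r : nat) :
  (forall i, (i.+1 < r)%N -> (Z i *m D i <= Z i.+1 *m D i.+1)%MS) ->
  #|free_images r|%:R
  = \prod_(i < r) (#|F|%:R ^+ \rank (Z i :&: kermx (D i))%MS
                   * (#|F|%:R ^+ \rank (Z i *m D i) - #|F|%:R ^+ i)) :> rat.
Proof.
elim: r => [|r IHr] nested.
  rewrite big_ord0 (_ : free_images 0 = setT) ?cardsT ?card_mx ?mul0n ?expn0 //.
  apply/setP=> W; rewrite !inE /row_free flatmx0 mxrank0 eqxx /=.
  by apply/forallP=> -[].
rewrite big_ord_recr /= -IHr => [|i lti]; last exact/nested/ltnW.
have mono i : (i <= r)%N -> (Z i *m D i <= Z r *m D r)%MS.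
  move: nested; elim: {IHr} r => [|r IH] nested; first by rewrite leqn0 => /eqP->.
  rewrite leq_eqVlt => /predU1P[-> // | lti].
  apply: submx_trans (nested r _) => //; apply: IH => // j ltj.
  exact/nested/ltnW.
move: nested => _; rewrite -(addn1 r).
have -> : #|free_images (r + 1)| = (\sum_(W in free_images r)
     #|[set w : 'rV_e | (w <= Z r)%MS
        && ~~ (w *m D r <= \matrix_(i < r) (row i W *m D i))%MS]|)%N.
  under eq_bigr do rewrite -sum1_card.
  rewrite pair_big_dep -sum1_card /=.
  rewrite (reindex (fun x : 'M_(r, e) * 'rV_e => col_mx x.1 x.2)) /=; last first.
    exists (fun W => (usubmx W, dsubmx W)) => [[W w] _|W _] /=.
      by rewrite col_mxKu col_mxKd.
    by rewrite vsubmxK.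
  apply: eq_bigl => -[W w]; rewrite !inE /=.
  have -> : \matrix_(i < r + 1) (row i (col_mx W w) *m D i)
      = col_mx (\matrix_(i < r) (row i W *m D i)) (w *m D r).
    apply/row_matrixP=> i; rewrite rowK; case: (split_ordP i) => j ->.
      by rewrite !rowKu rowK.
    by rewrite !rowKd !row_id /= ord1 addn0.
  rewrite row_free_col_mx -!andbA; congr (_ && _); rewrite [RHS]andbA [RHS]andbC.
  congr (_ && _).
  apply/forallP/andP=> [sW | [/forallP sW sw] i].
    split; last by have := sW (rshift r ord0); rewrite rowKd row_id /= addn0.
    by apply/forallP=> i; have := sW (lshift 1 i); rewrite rowKu.
  case: (split_ordP i) => j ->; first by rewrite rowKu sW.
  by rewrite rowKd row_id /= ord1 addn0.
rewrite natr_sum (eq_bigr (fun=> #|F|%:R ^+ \rank (Z r :&: kermx (D r))%MS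
   * (#|F|%:R ^+ \rank (Z r *m D r) - #|F|%:R ^+ r))) ?sumr_const ?mulr_natl // => W.
rewrite inE => /andP[freeW /forallP sW]; apply: card_preim_notin => //.
apply/row_subP=> i; rewrite rowK; apply: submx_trans (mono i (ltnW (ltn_ord i))).
exact: submxMr.
Qed.

End CountingFreeImages.

(** * Jordan systems *)

Lemma mulmx_exprD (R : pzRingType) (a d : nat) (x : 'M[R]_(a, d)) (Q : 'M[R]_d) i j :
  x *m Q ^+ i *m Q ^+ j = x *m Q ^+ (i + j).
Proof. by rewrite -mulmxA mulmxE -exprD. Qed.

Section JordanSystem.

Variables (F : fieldType) (d : nat) (Q : 'M[F]_d).

(* [u i] generates the i-th Jordan block, of size [k i], and [c i] is the coordinate
   functional of its last vector [u i *m Q ^+ (k i).-1]. The other coordinates are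
   the [Q ^+ j *m c i], hence the last clause, and transposing [Q] exchanges the
   roles of [u] and [c]. Blocks are sorted by decreasing size. *)
Definition jordan_system (r : nat) (k : nat -> nat) (u : nat -> 'rV[F]_d)
    (c : nat -> 'cV[F]_d) : Prop :=
  [/\ forall i, (i < r)%N -> (0 < k i)%N,
      forall i j, (i <= j < r)%N -> (k j <= k i)%N,
      forall i i' j, (i < r)%N -> (i' < r)%N ->
        u i *m Q ^+ j *m c i' = ((i == i') && (j.+1 == k i))%:R%:M
    & \sum_(i < r) \sum_(j < k i) Q ^+ (k i - j.+1) *m c i *m (u i *m Q ^+ j)
      = 1%:M].

(** As [t] varies this is the partition conjugate to the block sizes; [rank_jordan_socle] identifies
    it with [Delta]. *)
Definition num_blocks (r : nat) (k : nat -> nat) (t : nat) : nat :=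
  \sum_(i < r) (t <= k i)%N.

Lemma num_blocks_le r k t : (num_blocks r k t <= r)%N.
Proof.
rewrite -[X in (_ <= X)%N]card_ord -sum1_card.
by apply: leq_sum => i _; case: (t <= _)%N.
Qed.

(** Sizes decrease, so the blocks of size at least [t] form an initial segment of the indices. *)
Lemma ltn_num_blocks r k t i :
  (forall i j, (i <= j < r)%N -> (k j <= k i)%N) -> (i < r)%N ->
  (i < num_blocks r k t)%N = (t <= k i)%N.
Proof.
rewrite /num_blocks; elim: r i => [//|r IHr] i kS lti; rewrite big_ord_recr /=.
have [tr|tr] := leqP t (k r).
  rewrite (eq_bigr (fun=> 1%N)) => [|j _].
    rewrite sum1_card card_ord addn1 lti; apply/esym/(leq_trans tr)/kS.
    by rewrite -ltnS lti ltnSn.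
  by rewrite (leq_trans tr) // kS // ltnSn ltnW.
rewrite addn0; move: lti; rewrite ltnS leq_eqVlt => /predU1P[-> | lti].
  by rewrite [RHS]leqNgt tr ltnNge num_blocks_le.
apply: IHr => // i' j /andP[le_ij lt_jr]; apply: kS.
by rewrite le_ij ltnW.
Qed.

Variables (r : nat) (k : nat -> nat) (u : nat -> 'rV[F]_d) (c : nat -> 'cV[F]_d).
Hypothesis jQ : jordan_system r k u c.

Let k_gt0 i : (i < r)%N -> (0 < k i)%N. Proof. by case: jQ => H _ _ _; apply: H. Qed.
Let ucE i i' j : (i < r)%N -> (i' < r)%N ->
  u i *m Q ^+ j *m c i' = ((i == i') && (j.+1 == k i))%:R%:M.
Proof. by case: jQ => _ _ H _; apply: H. Qed.

(** Every coordinate pairs [u i] with a power of [Q] of exponent at least [k i], whereas only the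
    exponent [(k i).-1] pairs nontrivially. *)
Lemma jordan_uQ i : (i < r)%N -> u i *m Q ^+ k i = 0.
Proof.
move=> lti; rewrite -[LHS]mulmx1; case: jQ => _ _ _ <-.
rewrite mulmx_sumr big1 // => i' _; rewrite mulmx_sumr big1 // => j _.
rewrite !mulmxA -[u i *m _ *m _]mulmxA mulmxE -exprD ucE //.
by rewrite -addnS -{2}[k i]addn0 eqn_add2l andbF raddf0 !mul0mx.
Qed.

Lemma jordan_Qc i : (i < r)%N -> Q ^+ k i *m c i = 0.
Proof.
move=> lti; rewrite -[LHS]mul1mx; case: jQ => _ _ _ <-.
rewrite mulmx_suml big1 // => i' _; rewrite mulmx_suml big1 // => j _.
rewrite -!mulmxA [Q ^+ j *m _]mulmxA mulmxE -exprD [u i' *m _]mulmxA ucE //.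
case: andP => [[/eqP eq_i]|_]; last by rewrite raddf0 !mulmx0.
by rewrite -eq_i -addSn -[X in _ == X]add0n eqn_add2r.
Qed.

(** In the resolution of the identity, every coordinate functional containing a factor [Q] vanishes
    on [y]; only the last vector of each block remains. *)
Lemma jordan_row_socle a (y : 'M_(a, d)) : y *m Q = 0 ->
  y = \sum_(i < r) y *m c i *m (u i *m Q ^+ (k i).-1).
Proof.
move=> yQ; rewrite -[LHS]mulmx1; case: jQ => _ _ _ <-.
rewrite mulmx_sumr; apply: eq_bigr => i _; rewrite mulmx_sumr.
have [m km] : exists m, k i = m.+1 by exists (k i).-1; rewrite prednK ?k_gt0.
rewrite km big_ord_recr /= big1 => [|j _].
  by rewrite add0r subnn expr0 mul1mx !mulmxA.
rewrite !mulmxA subSS; have [n ->] : exists n, (m - j = n.+1)%N.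
  by exists (m - j).-1; rewrite prednK ?subn_gt0.
by rewrite exprS mulmxA yQ !mul0mx.
Qed.

Lemma jordan_col_socle a (y : 'M_(d, a)) : Q *m y = 0 ->
  y = \sum_(i < r) Q ^+ (k i).-1 *m c i *m (u i *m y).
Proof.
move=> Qy; rewrite -[LHS]mul1mx; case: jQ => _ _ _ <-.
rewrite mulmx_suml; apply: eq_bigr => i _; rewrite mulmx_suml.
have [m km] : exists m, k i = m.+1 by exists (k i).-1; rewrite prednK ?k_gt0.
rewrite km big_ord_recl /= big1 => [|j _].
  by rewrite addr0 subn1 expr0 mulmx1 !mulmxA.
by rewrite -!mulmxA /bump /= exprSr -mulmxA Qy !mulmx0.
Qed.

(** The last vectors of the blocks of size at least [t] form a basis; their independence is seen by
    pairing with the [c i]. *)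
Lemma rank_jordan_socle t :
  (0 < t)%N -> \rank (Q ^+ t.-1 :&: kermx Q)%MS = num_blocks r k t.
Proof.
move=> t_gt0; set m := num_blocks r k t.
have kS : forall i j, (i <= j < r)%N -> (k j <= k i)%N by case: jQ.
have ltr (i : 'I_m) : (i < r)%N := leq_trans (ltn_ord i) (num_blocks_le r k t).
pose B := \matrix_(i < m) (u i *m Q ^+ (k i).-1).
have freeB : row_free B.
  apply/row_freeP; exists (\matrix_(x < d, i < m) c i x 0).
  apply/matrixP=> i j; rewrite mxE.
  have := ucE (k i).-1 (ltr i) (ltr j); rewrite prednK ?k_gt0 // eqxx andbT.
  move/matrixP/(_ 0 0); rewrite !mxE eqxx mulr1n => <-; apply: eq_bigr => x _.
  by rewrite !mxE.
rewrite -(eqP freeB); apply/esym/eqmx_rank/andP; split.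
  apply/row_subP=> i; rewrite rowK sub_capmx; apply/andP; split; last first.
    apply/sub_kermxP; rewrite -mulmxA mulmxE -exprSr prednK ?k_gt0 //.
    exact: jordan_uQ.
  have le_tk : (t <= k i)%N by rewrite -(ltn_num_blocks t kS).
  have -> : ((k i).-1 = (k i - t) + t.-1)%N.
    by rewrite -subn1 -[in LHS](subnK le_tk) -addnBA // subn1.
  by rewrite exprD mulmxA submxMl.
apply/row_subP=> x; set y := row x _.
have : (y <= Q ^+ t.-1 :&: kermx Q)%MS by apply: row_sub.
rewrite sub_capmx => /andP[/submxP[z ->] /sub_kermxP yQ].
rewrite (jordan_row_socle yQ) summx_sub // => i _.
have [tk|kt] := leqP t (k i).
  have ltm : (i < m)%N by rewrite (ltn_num_blocks t kS).
  by have := row_sub (Ordinal ltm) B; rewrite rowK => sub; rewrite mulmx_sub.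
(* A block shorter than [t] contributes nothing, because [Q ^+ k i] kills [c i]. *)
have -> : (t.-1 = (t.-1 - k i) + k i)%N by rewrite subnK // -ltnS prednK.
by rewrite exprD -!mulmxA [Q ^+ k i *m _]mulmxA jordan_Qc // mul0mx !mulmx0 sub0mx.
Qed.

End JordanSystem.

Lemma addn_subS_eq (i j m : nat) : (j < m)%N -> ((i + (m - j.+1)).+1 == m) = (i == j).
Proof. by move=> lt_jm; rewrite -addSn -{2}(subnKC lt_jm) eqn_add2r eqSS. Qed.

(** * Modules over a cyclic group as modules over one nilpotent matrix *)

Section CyclicModules.

Variables (F : fieldType) (gT : finGroupType) (G : {group gT}) (s : gT).
Variables (d : nat) (V : mx_representation F G d) (N : nat).
Hypothesis defG : G :=: <[s]>%g.
Local Notation T := (V s - 1%:M).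
Hypothesis nilT : T ^+ N = 0.

Let Gs : s \in G. Proof. by rewrite defG cycle_id. Qed.
Let GX x : x \in G -> exists j, x = (s ^+ j)%g.
Proof. by rewrite defG => /cycleP[j ->]; exists j. Qed.

Lemma repr_mx_expg j : V (s ^+ j)%g = V s ^+ j.
Proof.
elim: j => [|j IHj]; first by rewrite repr_mx1.
by rewrite exprSr expgSr repr_mxM ?groupX // IHj.
Qed.

(** A vector fixed by the generator is fixed by all its powers, so [Delta] depends on the single
    operator [T]. *)
Lemma rank_rfix_cycle a (W : 'M_(a, d)) :
  \rank (W :&: rfix_mx V G)%MS = \rank (W :&: kermx T)%MS.
Proof.
apply/eqmx_rank/andP; split; rewrite sub_capmx capmxSl /=.
  apply/sub_kermxP; rewrite mulmxBr mulmx1; apply/eqP; rewrite subr_eq0; apply/eqP.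
  by have /rfix_mxP-> := capmxSr W (rfix_mx V G).
apply/rfix_mxP=> x /GX[j ->]; rewrite repr_mx_expg.
have fixW : (W :&: kermx T)%MS *m V s = (W :&: kermx T)%MS.
  have /sub_kermxP := capmxSr W (kermx T).
  by rewrite mulmxBr mulmx1 => /eqP; rewrite subr_eq0 => /eqP.
by elim: j => [|j IHj]; rewrite ?expr0 ?mulmx1 // exprSr mulmxA IHj.
Qed.

Lemma mxmodule_cycle a (W : 'M_(a, d)) : (W *m T <= W)%MS -> mxmodule V W.
Proof.
move=> sWT; have sWs : (W *m V s <= W)%MS.
  by rewrite -(subrK 1%:M (V s)) mulmxDr mulmx1 addmx_sub.
apply/mxmoduleP=> x /GX[j ->]; rewrite repr_mx_expg.
elim: j => [|j IHj]; first by rewrite expr0 mulmx1.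
by rewrite exprSr mulmxA (submx_trans (submxMr _ IHj)).
Qed.

Lemma cyclic_mx_pow (g : 'rV_d) j : (g *m T ^+ j <= cyclic_mx V g)%MS.
Proof.
elim: j => [|j IHj]; first by rewrite expr0 mulmx1 cyclic_mx_id.
rewrite exprSr mulmxA mulmxBr mulmx1 addmx_sub ?eqmx_opp //.
by apply: mxmodule_trans IHj => //; apply: cyclic_mx_module.
Qed.

(** With [h] the least exponent such that [g *m T ^+ h = 0], the first [h] iterates of [g] are
    independent and span a submodule; hence [h] is the dimension. *)
Lemma cyclic_mx_basis (g : 'rV_d) : let k := \rank (cyclic_mx V g) in
  [/\ g *m T ^+ k = 0, row_free (\matrix_(j < k) (g *m T ^+ j))
    & (\matrix_(j < k) (g *m T ^+ j) :=: cyclic_mx V g)%MS].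
Proof.
have exg : exists h, g *m T ^+ h == 0 by exists N; rewrite nilT mulmx0.
case: (ex_minnP exg) => h /eqP gh minh.
pose B := \matrix_(j < h) (g *m T ^+ j).
have gj0 j : (h <= j)%N -> g *m T ^+ j = 0.
  by move=> le_hj; rewrite -(subnKC le_hj) exprD mulmxA gh mul0mx.
have freeB : row_free B.
  apply: inj_row_free => v vB.
  suff v0 m : forall j : 'I_h, (j < m)%N -> v 0 j = 0.
    by apply/rowP=> j; rewrite mxE (v0 h).
  elim: m => [//|m IHm] j; rewrite ltnS leq_eqVlt => /predU1P[jm | /IHm //].
  (* This power kills the terms after [j], the coefficients before [j] vanish by induction, and
     [g *m T ^+ h.-1] is nonzero by minimality of [h]. *)
  have : v *m B *m T ^+ (h - j.+1) = 0 by rewrite vB mul0mx.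
  rewrite [v *m B]mulmx_sum_row mulmx_suml (bigD1 j) //= big1 => [|i neq_ij].
    rewrite addr0 rowK -scalemxAl -mulmxA mulmxE -exprD => /eqP.
    rewrite scaler_eq0 => /orP[/eqP //|/minh].
    by rewrite leqNgt -addSn subnKC ?leqnn.
  rewrite rowK -scalemxAl; have [lt_ij|] := ltnP i j.
    by rewrite IHm ?scale0r // -jm.
  rewrite leq_eqVlt eq_sym (inj_eq val_inj) (negPf neq_ij) /= => lt_ji.
  rewrite -mulmxA mulmxE -exprD gj0 ?scaler0 //.
  by rewrite -[X in (X <= _)%N](subnKC (ltn_ord j)) leq_add2r.
have eqB : (B :=: cyclic_mx V g)%MS.
  apply/eqmxP/andP; split.
    by apply/row_subP=> j; rewrite rowK cyclic_mx_pow.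
  have sB j : (g *m T ^+ j <= B)%MS.
    have [/gj0->|ltj] := leqP h j; first exact: sub0mx.
    by have := row_sub (Ordinal ltj) B; rewrite rowK.
  apply: cyclic_mx_sub; last by have := sB 0%N; rewrite expr0 mulmx1.
  apply: mxmodule_cycle; apply/row_subP=> j; rewrite row_mul rowK.
  by rewrite -mulmxA mulmxE -exprSr.
by rewrite -eqB (eqP freeB).
Qed.

End CyclicModules.

(** * A Jordan system from a cyclic decomposition *)

Section JordanOfDecomposition.

Variables (p : nat) (gT : finGroupType) (G : {group gT}) (s : gT).
Variables (d : nat) (V : mx_representation 'F_p G d) (N : nat).
Variable dV : cyclic_decomposition V.
Hypothesis defG : G :=: <[s]>%g.
Local Notation T := (V s - 1%:M).
Hypothesis nilT : T ^+ N = 0.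

Local Notation g := (@cd_gen _ _ _ _ _ dV).
Local Notation W := (fun i => cyclic_mx V (g i)).
Local Notation k := (fun i => \rank (W i)).

(** Project onto the i-th summand, read the coordinates in the basis of iterates of [g i] through
    [pinvmx], and keep the last one. *)
Definition cd_cogen (i : 'I_(cd_size dV)) : 'cV['F_p]_d :=
  proj_mx (W i) (\sum_(j | j != i) W j)%MS
  *m (pinvmx (\matrix_(j < k i) (g i *m T ^+ j)) *m (\col_(j < k i) (j.+1 == k i)%:R)).

Lemma cd_cogenE i i' j :
  g i *m T ^+ j *m cd_cogen i' = ((i == i') && (j.+1 == k i))%:R%:M.
Proof.
rewrite mulmxA; have [gk freeB eqB] := cyclic_mx_basis defG nilT (g i).
have dx x : (W x :&: (\sum_(j | j != x) W j) = 0)%MS.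
  exact: (mxdirect_sumsP (cd_direct dV)).
have [<- | neq] /= := eqVneq i i'; last first.
  rewrite proj_mx_0 ?mul0mx ?raddf0 //.
    apply: submx_trans (cyclic_mx_pow V defG _ _) _.
  exact: (sumsmx_sup i).
rewrite proj_mx_id ?(cyclic_mx_pow V defG) //.
have [le_kj | lt_jk] := leqP (k i) j.
  have -> : g i *m T ^+ j = 0 by rewrite -(subnKC le_kj) exprD mulmxA gk mul0mx.
  by rewrite !mul0mx gtn_eqF ?raddf0.
have -> : g i *m T ^+ j = row (Ordinal lt_jk) (\matrix_(j < k i) (g i *m T ^+ j)).
  by rewrite rowK.
rewrite -row_mul mulmxA mulmxVp // mul1mx.
by apply/matrixP=> x y; rewrite !ord1 !mxE eqxx mulr1n.
Qed.

Lemma cd_span a (y : 'M_(d, a)) : (forall i j, g i *m T ^+ j *m y = 0) -> y = 0.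
Proof.
move=> gy; rewrite -[y]mul1mx; apply/sub_kermxP; rewrite -(cd_full dV).
apply/sumsmx_subP=> i _; have [_ _ <-] := cyclic_mx_basis defG nilT (g i).
by apply/row_subP=> j; rewrite rowK; apply/sub_kermxP.
Qed.

Lemma cd_cogen_kill i : T ^+ k i *m cd_cogen i = 0.
Proof.
apply: cd_span => i' j; rewrite mulmxA -[g i' *m _ *m _]mulmxA mulmxE -exprD.
rewrite cd_cogenE; case: andP => [[/eqP -> /eqP]|_]; last by rewrite raddf0.
by move/eqP; rewrite -addSn -[X in _ == X]add0n eqn_add2r.
Qed.

(** Summands of dimension 0 are dropped and the others sorted. The resolution of the identity is
    checked on the spanning vectors [g i *m T ^+ j], where a single term survives. *)
Lemma cd_jordan : exists r k u c, jordan_system T r k u c.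
Proof.
move: (cd_cogen) cd_cogenE => c cE.
have [sz0 | i0] : (cd_size dV = 0)%N + 'I_(cd_size dV).
- case: (cd_size dV) => [|m]; [by left | right; exact: ord0].
- exists 0%N, (fun=> 0%N), (fun=> 0), (fun=> 0).
  split=> //; rewrite ?big_ord0; apply/esym/cd_span => i.
  by have := ltn_ord i; rewrite {2}sz0.
pose R (i j : 'I_(cd_size dV)) := (k j <= k i)%N.
pose l := sort R [seq i <- enum 'I_(cd_size dV) | (0 < k i)%N].
have mem_l i : (i \in l) = (0 < k i)%N by rewrite mem_sort mem_filter mem_enum andbT.
have uniq_l : uniq l by rewrite sort_uniq filter_uniq ?enum_uniq.
have nth_l i : (i < size l)%N -> nth i0 l i \in l.
  exact: mem_nth.
pose f := nth i0 l.
exists (size l), (fun i => k (f i)), (fun i => g (f i)), (fun i => c (f i)).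
split.
- by move=> i /nth_l; rewrite mem_l.
- move=> i j /andP[le_ij lt_j].
  have R_trans : transitive R by move=> x y z h1 h2; apply: leq_trans h2 h1.
  have R_refl : reflexive R by move=> x; apply: leqnn.
  have R_sorted : sorted R l by apply: sort_sorted => x y; apply: leq_total.
  have /(_ i j) R_nth := sorted_leq_nth R_trans R_refl i0 R_sorted.
  by have := R_nth (leq_ltn_trans le_ij lt_j) lt_j le_ij.
- by move=> i i' j lti lti'; rewrite cE nth_uniq.
apply/eqP; rewrite -subr_eq0; apply/eqP/cd_span => i j.
rewrite mulmxBr mulmx1; apply/eqP; rewrite subr_eq0; apply/eqP.
have [le_kj|lt_jk] := leqP (k i) j.
  have [gk _ _] := cyclic_mx_basis defG nilT (g i).
  have -> : g i *m T ^+ j = 0 by rewrite -(subnKC le_kj) exprD mulmxA gk mul0mx.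
  by rewrite mul0mx.
have li : i \in l by rewrite mem_l (leq_ltn_trans _ lt_jk).
have lt_il : (index i l < size l)%N by rewrite index_mem.
have fi : f (index i l) = i by rewrite /f nth_index.
rewrite mulmx_sumr (bigD1 (Ordinal lt_il)) //= fi [X in _ + X]big1 => [|i' neq].
  rewrite addr0 mulmx_sumr (bigD1 (Ordinal lt_jk)) //= big1 => [|j' neq].
    rewrite addr0 !mulmxA mulmx_exprD cE eqxx /=.
    by rewrite (addn_subS_eq _ lt_jk) eqxx mul1mx.
  rewrite !mulmxA mulmx_exprD cE eqxx /=.
  rewrite (addn_subS_eq _ (ltn_ord j')).
  by rewrite eq_sym -[_ == _]/(j' == Ordinal lt_jk) (negPf neq) raddf0 !mul0mx.
rewrite mulmx_sumr big1 // => j' _.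
rewrite !mulmxA mulmx_exprD cE.
rewrite -{1}fi nth_uniq // eq_sym -[_ == _]/(i' == Ordinal lt_il) (negPf neq).
by rewrite raddf0 !mul0mx.
Qed.

End JordanOfDecomposition.

(** * Intertwiners *)

Lemma trmx_expr (R : comPzRingType) (d : nat) (Q : 'M[R]_d) j :
  (Q ^+ j)^T = Q^T ^+ j.
Proof.
elim: j => [|j IHj]; first by rewrite !expr0 trmx1.
by rewrite exprS exprSr -IHj -!mulmxE trmx_mul.
Qed.

Lemma intertwine_expr (R : pzRingType) (e d : nat) (P : 'M[R]_e) (Q : 'M[R]_d)
    (X : 'M[R]_(e, d)) j : P *m X = X *m Q -> P ^+ j *m X = X *m Q ^+ j.
Proof.
move=> comX; elim: j => [|j IHj]; first by rewrite !expr0 mul1mx mulmx1.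
by rewrite exprSr -mulmxE -mulmxA comX mulmxA IHj -mulmxA mulmxE -exprSr.
Qed.

(** Multiplying by [P] or by [Q] gives the same sum up to a shift of the index by one, and the two
    end terms vanish by hypothesis. *)
Lemma shift_sum_intertwine (R : pzRingType) (a e d : nat) (P : 'M[R]_e)
    (Q : 'M[R]_d) (w : 'M[R]_(e, a)) (u : 'M[R]_(a, d)) k :
  P ^+ k *m w = 0 -> u *m Q ^+ k = 0 ->
  P *m (\sum_(j < k) P ^+ (k - j.+1) *m w *m (u *m Q ^+ j))
  = (\sum_(j < k) P ^+ (k - j.+1) *m w *m (u *m Q ^+ j)) *m Q.
Proof.
move=> Pw uQ; pose f j := P ^+ (k - j) *m w *m (u *m Q ^+ j).
have -> : P *m (\sum_(j < k) P ^+ (k - j.+1) *m w *m (u *m Q ^+ j)) = \sum_(j < k) f j.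
  rewrite mulmx_sumr; apply: eq_bigr => j _; rewrite /f.
  have -> : P ^+ (k - j) = P *m P ^+ (k - j.+1).
    by rewrite mulmxE -exprS subnSK.
  by rewrite !mulmxA.
rewrite mulmx_suml [RHS](eq_bigr (fun j : 'I_k => f j.+1)) => [|j _]; last first.
  rewrite /f; have -> : Q ^+ j.+1 = Q ^+ j *m Q by rewrite exprSr.
  by rewrite !mulmxA.
have f0 : f 0%N = 0 by rewrite /f subn0 Pw mul0mx.
have fk : f k = 0 by rewrite /f uQ mulmx0.
by rewrite -[LHS]addr0 -[X in _ + X]fk -(big_ord_recr k f) big_ord_recl /= f0 add0r.
Qed.

(** This is [Delta] with the fixed space written as the kernel of [Q]. Because of the truncated
    predecessor, the index 0 has the same value as the index 1. *)
Definition soc_rank (F : fieldType) (d : nat) (Q : 'M[F]_d) (t : nat) : nat :=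
  \rank (Q ^+ t.-1 :&: kermx Q)%MS.

Lemma soc_rankD (F : fieldType) (d : nat) (Q : 'M[F]_d) (t : nat) :
  (\rank (Q ^+ t.+1) + soc_rank Q t.+1)%N = \rank (Q ^+ t).
Proof. by rewrite -(mxrank_mul_ker (Q ^+ t) Q) mulmxE -exprSr. Qed.

Lemma rank_ker_expr (F : fieldType) (d : nat) (Q : 'M[F]_d) (t : nat) :
  \rank (kermx (Q ^+ t)) = (\sum_(1 <= j < t.+1) soc_rank Q j)%N.
Proof.
rewrite mxrank_ker; elim: t => [|t IHt].
  by rewrite big_nil expr0 mxrank1 subnn.
rewrite big_nat_recr //= -IHt.
have := rank_leq_row (Q ^+ t); rewrite -(soc_rankD Q t) => le_d.
by rewrite subnDA subnK // leq_subRL ?(leq_trans (leq_addr _ _) le_d).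
Qed.

(** * Surjective intertwiners encoded by dual generators *)

Section Intertwiners.

Variables (F : finFieldType) (e d : nat) (P : 'M[F]_e) (Q : 'M[F]_d) (N : nat).
Variables (r : nat) (k : nat -> nat) (u : nat -> 'rV[F]_d) (c : nat -> 'cV[F]_d).
Hypotheses (nilQ : Q ^+ N = 0) (jQ : jordan_system Q r k u c).

Definition surj_intertwiners : {set 'M[F]_(e, d)} :=
  [set X | (P *m X == X *m Q) && row_full X].

Let k_gt0 i : (i < r)%N -> (0 < k i)%N. Proof. by case: jQ => H _ _ _; apply: H. Qed.
Let ucE i i' j : (i < r)%N -> (i' < r)%N ->
  u i *m Q ^+ j *m c i' = ((i == i') && (j.+1 == k i))%:R%:M.
Proof. by case: jQ => _ _ H _; apply: H. Qed.

(** This is [X] times the resolution of the identity of [Q], with the powers of [Q] moved across [X]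
    to become powers of [P]; row [i] of [W] stands for the transpose of [X *m c i]. *)
Definition inter_of_rows (W : 'M[F]_(r, e)) : 'M[F]_(e, d) :=
  \sum_(i < r) \sum_(j < k i) P ^+ (k i - j.+1) *m (row i W)^T *m (u i *m Q ^+ j).

Definition rows_of_inter (X : 'M[F]_(e, d)) : 'M[F]_(r, e) :=
  \matrix_(i < r) (X *m c i)^T.

Let Z (i : nat) := kermx (P^T ^+ k i).
Let D (i : nat) := P^T ^+ (k i).-1.

Lemma rows_of_interK X : P *m X = X *m Q -> inter_of_rows (rows_of_inter X) = X.
Proof.
move=> comX; rewrite -[RHS]mulmx1; case: jQ => _ _ _ <-.
rewrite mulmx_sumr; apply: eq_bigr => i _; rewrite mulmx_sumr.
apply: eq_bigr => j _; rewrite rowK trmxK !mulmxA.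
by rewrite (intertwine_expr _ comX).
Qed.

Lemma row_kerP W (i : 'I_r) :
  reflect (P ^+ k i *m (row i W)^T = 0) (row i W <= Z i)%MS.
Proof.
apply: (iffP sub_kermxP) => [rW|rW]; apply: trmx_inj.
  by rewrite trmx_mul trmxK trmx_expr rW trmx0.
by rewrite trmx_mul -trmx_expr trmxK rW trmx0.
Qed.

Lemma inter_of_rows_comm W : (forall i : 'I_r, (row i W <= Z i)%MS) ->
  P *m inter_of_rows W = inter_of_rows W *m Q.
Proof.
move=> sW; rewrite mulmx_sumr mulmx_suml; apply: eq_bigr => i _.
by apply: shift_sum_intertwine; [apply/row_kerP | apply: (jordan_uQ jQ)].
Qed.

Lemma inter_of_rowsK W : rows_of_inter (inter_of_rows W) = W.
Proof.
apply/row_matrixP=> i; rewrite rowK; apply: trmx_inj; rewrite trmxK.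
have [m km] : exists m, k i = m.+1 by exists (k i).-1; rewrite prednK ?k_gt0.
have ltm : (m < k i)%N by rewrite km.
rewrite mulmx_suml (bigD1 i) //= [X in _ + X]big1 => [|i' neq].
  rewrite addr0 mulmx_suml (bigD1 (Ordinal ltm)) //= big1 => [|j neq].
    by rewrite addr0 -mulmxA ucE // eqxx km /= eqxx subnn expr0 mul1mx mulmx1.
  rewrite -mulmxA ucE //; case: andP => [[_ /eqP jk]|_]; last by rewrite raddf0 mulmx0.
  by case/eqP: neq; apply/val_inj/succn_inj; rewrite /= jk.
rewrite mulmx_suml big1 // => j _; rewrite -mulmxA ucE //.
by rewrite -[(i' == i :> nat)]/(i' == i) (negPf neq) raddf0 mulmx0.
Qed.

Lemma row_of_inter_ker X (i : 'I_r) :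
  P *m X = X *m Q -> (row i (rows_of_inter X) <= Z i)%MS.
Proof.
move=> comX; apply/row_kerP; rewrite rowK trmxK mulmxA (intertwine_expr _ comX).
by rewrite -mulmxA (jordan_Qc jQ) ?mulmx0.
Qed.

Lemma row_of_inter_soc X (i : 'I_r) : P *m X = X *m Q ->
  row i (rows_of_inter X) *m D i = (Q ^+ (k i).-1 *m c i)^T *m X^T.
Proof.
move=> comX; rewrite /D rowK -trmx_expr -!trmx_mul !mulmxA.
by rewrite (intertwine_expr _ comX).
Qed.

(** Surjectivity of [X] is injectivity of [z |-> X *m z], which for nilpotent [Q] is decided on the
    columns killed by [Q]. These are spanned by the transposed rows of [C], the last vectors of the
    dual blocks. *)
Lemma row_full_inter X : P *m X = X *m Q ->
  row_full X = row_free (\matrix_(i < r) (row i (rows_of_inter X) *m D i)).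
Proof.
move=> comX; have -> : row_full X = row_free X^T by rewrite /row_free mxrank_tr.
pose C := \matrix_(i < r) (Q ^+ (k i).-1 *m c i)^T.
have -> : \matrix_(i < r) (row i (rows_of_inter X) *m D i) = C *m X^T.
  apply/row_matrixP=> i; rewrite rowK row_of_inter_soc // row_mul.
  by rewrite rowK.
have freeC : row_free C.
  apply/row_freeP; exists (\matrix_(x < d, i < r) u i 0 x).
  apply/matrixP=> i j; rewrite mxE.
  have := ucE (k i).-1 (ltn_ord j) (ltn_ord i); rewrite prednK ?k_gt0 //.
  have -> : (j == i :> nat) && (k i == k j) = (j == i).
    by have [->|] := eqVneq j i; rewrite ?eqxx // => /negPf; rewrite -val_eqE /= => ->.
  rewrite -mulmxA => /matrixP/(_ 0 0); rewrite !mxE eqxx mulr1n.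
  rewrite eq_sym => <-; apply: eq_bigr => x _.
  by rewrite !mxE [LHS]mulrC.
apply/idP/idP => [freeX | freeCX].
  by rewrite /row_free mxrankMfree // (eqP freeC).
apply: inj_row_free => v vX.
(* Since [X] intertwines, induction on the power of [Q] killing [z] reduces to the case
   [Q *m z = 0]. *)
suff z0 m : forall z : 'cV_d, Q ^+ m *m z = 0 -> X *m z = 0 -> z = 0.
  apply: trmx_inj; rewrite trmx0; apply: (z0 N); first by rewrite nilQ mul0mx.
  by apply: trmx_inj; rewrite trmx_mul trmxK vX trmx0.
elim: m => [|m IHm] z Qz Xz; first by rewrite -Qz expr0 mul1mx.
have Qz0 : Q *m z = 0.
  apply: IHm; first by rewrite mulmxA mulmxE -exprSr.
  by rewrite mulmxA -comX -mulmxA Xz mulmx0.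
have zE := jordan_col_socle jQ Qz0.
pose t := \row_(i < r) (u i *m z) 0 0.
have t0 : t = 0.
  have : t *m (C *m X^T) = 0.
    rewrite mulmxA; have -> : t *m C = z^T.
      rewrite mulmx_sum_row [in RHS]zE raddf_sum /=; apply: eq_bigr => i _.
      rewrite rowK [in RHS](mx11_scalar (u i *m z)) [RHS]trmx_mul tr_scalar_mx mul_scalar_mx.
      by rewrite [t 0 i]mxE.
    by rewrite -trmx_mul Xz trmx0.
  by move=> tC; apply: (row_free_inj freeCX); rewrite mul0mx.
rewrite zE big1 // => i _; rewrite [u i *m z]mx11_scalar.
have := congr1 (fun M : 'rV_r => M 0 i) t0.
by rewrite [t 0 i]mxE => ->; rewrite mxE raddf0 mulmx0.
Qed.

Lemma rank_soc_dom i : (0 < k i)%N ->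
  \rank (Z i :&: kermx (D i))%MS = (\sum_(1 <= j < k i) soc_rank P j)%N.
Proof.
move=> ki; have -> : \rank (Z i :&: kermx (D i))%MS = \rank (kermx (D i)).
  apply/eqmx_rank; rewrite capmxSr sub_capmx submx_refl andbT /=; apply/sub_kermxP.
  by rewrite -[in P^T ^+ k i](prednK ki) exprSr -mulmxE mulmxA mulmx_ker mul0mx.
rewrite mxrank_ker /D -trmx_expr mxrank_tr -mxrank_ker rank_ker_expr.
by rewrite prednK.
Qed.

Lemma rank_soc_img i : (0 < k i)%N -> \rank (Z i *m D i) = soc_rank P (k i).
Proof.
move=> ki; have := mxrank_mul_ker (Z i) (D i).
rewrite rank_soc_dom // /Z mxrank_ker -trmx_expr mxrank_tr -mxrank_ker rank_ker_expr.
by rewrite big_nat_recr //= addnC => /addnI.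
Qed.

(** Applying [P^T] another [k i - k j] times turns an admissible vector for block [i] into one for
    the shorter block [j] with the same final image. *)
Let Z_nested i j : (0 < k j <= k i)%N -> (Z i *m D i <= Z j *m D j)%MS.
Proof.
case/andP=> kj le_ji; have ki := leq_trans kj le_ji.
have -> : Z i *m D i = Z i *m P^T ^+ (k i - k j) *m D j.
  rewrite mulmx_exprD; congr (_ *m _ ^+ _).
  by rewrite -subn1 -[in LHS](subnK le_ji) -addnBA // subn1.
apply: submxMr; apply/sub_kermxP.
by rewrite mulmx_exprD subnK // mulmx_ker.
Qed.

Lemma card_surj_intertwiners : #|surj_intertwiners|%:R
  = \prod_(i < r) (#|F|%:R ^+ (\sum_(1 <= j < k i) soc_rank P j)
                   * (#|F|%:R ^+ soc_rank P (k i) - #|F|%:R ^+ i)) :> rat.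
Proof.
have -> : surj_intertwiners = inter_of_rows @: free_images Z D r.
  apply/setP=> X; apply/idP/imsetP=> [|[W]].
    rewrite inE => /andP[/eqP comX fullX]; exists (rows_of_inter X).
      rewrite inE -row_full_inter // fullX /=; apply/forallP=> i.
      exact: row_of_inter_ker.
    by rewrite rows_of_interK.
  rewrite !inE => /andP[freeW /forallP sW] ->.
  have comX := inter_of_rows_comm sW; rewrite comX eqxx row_full_inter //.
  by rewrite inter_of_rowsK.
rewrite card_imset; last exact: can_inj inter_of_rowsK.
rewrite card_free_images => [|i lti].
  by apply: eq_bigr => i _; rewrite rank_soc_dom ?rank_soc_img ?k_gt0.
apply: Z_nested; case: jQ => _ kS _ _.
by rewrite k_gt0 // kS // leqnSn lti.
Qed.

(** * Intertwiners sending a given vector into the image of a power *)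

Section Height.

Variables (alpha : 'rV[F]_e) (lam : nat).
Hypotheses (lam_gt0 : (0 < lam)%N) (alphaP : alpha *m P ^+ lam = 0).
Hypothesis alpha_height : ~~ (alpha *m P ^+ lam.-1 <= P ^+ lam)%MS.
Local Notation x := (alpha *m P ^+ lam.-1).

(** The vector [x *m X] is killed by [Q], hence a combination of last vectors of blocks. Blocks
    shorter than [lam] do not occur in it, and longer ones end inside the image of [Q ^+ lam]; only
    size [lam] matters. *)
Lemma intertwiner_low_height X : P *m X = X *m Q ->
  (x *m X <= Q ^+ lam)%MS
  = [forall i : 'I_r, (k i == lam) ==> (x *m X *m c i == 0)].
Proof.
move=> comX; apply/idP/forallP=> [/submxP[z ->] i | xc].
  by apply/implyP=> /eqP <-; rewrite -mulmxA (jordan_Qc jQ) // mulmx0.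
have xX : x *m X = alpha *m X *m Q ^+ lam.-1.
  by rewrite -mulmxA (intertwine_expr _ comX) mulmxA.
have xXQ : x *m X *m Q = 0.
  rewrite xX -mulmxA mulmxE -exprSr prednK // -mulmxA -(intertwine_expr _ comX).
  by rewrite mulmxA alphaP mul0mx.
rewrite (jordan_row_socle jQ xXQ) summx_sub // => i _.
case: (ltngtP (k i) lam) => [lt_kl | lt_lk | eq_kl].
- have -> : x *m X *m c i = 0.
    have lel : (k i <= lam.-1)%N by rewrite -ltnS prednK.
    rewrite xX -(subnK lel) -mulmx_exprD -[_ *m c i]mulmxA (jordan_Qc jQ) //.
    by rewrite mulmx0.
  by rewrite mul0mx sub0mx.
- have lel : (lam <= (k i).-1)%N by rewrite -ltnS prednK // (leq_ltn_trans _ lt_lk).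
  by rewrite -(subnK lel) -mulmx_exprD mulmxA submxMl.
have := xc i; rewrite eq_kl eqxx => /eqP ->.
by rewrite mul0mx sub0mx.
Qed.

(** The extra condition on row [i] expresses that [x *m X *m c i] vanishes. *)
Let Z' (i : nat) :=
  if k i == lam then (Z i :&: kermx (D i *m alpha^T))%MS else Z i.

Let Z'_dom i : (0 < k i)%N ->
  \rank (Z' i :&: kermx (D i))%MS = (\sum_(1 <= j < k i) soc_rank P j)%N.
Proof.
move=> ki; rewrite -rank_soc_dom // /Z'; case: eqP => // _.
apply/eqmx_rank/andP; split; first by rewrite capmxS ?capmxSl.
rewrite sub_capmx capmxSr andbT sub_capmx capmxSl /=; apply/sub_kermxP.
by rewrite mulmxA (sub_kermxP (capmxSr _ _)) mul0mx.
Qed.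

(** The extra functional is nonzero on [Z i] and factors through [D i], so it lowers the rank of the
    image by exactly one. *)
Let Z'_img i : (0 < k i)%N ->
  \rank (Z' i *m D i) = (soc_rank P (k i) - (k i == lam))%N.
Proof.
move=> ki; rewrite /Z'; case: eqP => [kl|_]; last by rewrite subn0 rank_soc_img.
have := mxrank_mul_ker (Z i :&: kermx (D i *m alpha^T))%MS (D i).
have := Z'_dom ki; rewrite /Z' kl eqxx -kl => ->.
have := mxrank_mul_ker (Z i) (D i); rewrite rank_soc_dom // rank_soc_img //.
have := mxrank_mul_ker (Z i) (D i *m alpha^T).
have -> : \rank (Z i *m (D i *m alpha^T)) = 1%N.
  apply/eqP; rewrite eqn_leq rank_leq_col lt0n mxrank_eq0.
  apply: contra alpha_height => /eqP Zx; rewrite submxE; apply/eqP/trmx_inj.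
  (* The rows of the transposed cokernel of [P ^+ lam] lie in [Z i]; a functional vanishing on them
     would put [x] in the image of [P ^+ lam]. *)
  rewrite trmx0 trmx_mul; have : ((cokermx (P ^+ lam))^T <= Z i)%MS.
    by apply/sub_kermxP; rewrite kl -trmx_expr -trmx_mul mulmx_coker trmx0.
  case/submxP=> E ->; rewrite -mulmxA; move: Zx.
  by rewrite /D kl -trmx_expr -trmx_mul => ->; rewrite mulmx0.
move=> <- eq1 eq2; move: eq1; rewrite -eq2 addnA => /addIn ->.
by rewrite add1n subn1.
Qed.

Let Z'_nested i j : (0 < k j <= k i)%N -> (Z' i *m D i <= Z' j *m D j)%MS.
Proof.
case/andP=> kj le_ji; have ki := leq_trans kj le_ji.
have sZ : (Z' i <= Z i)%MS by rewrite /Z'; case: ifP => // _; apply: capmxSl.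
have -> : Z' i *m D i = Z' i *m P^T ^+ (k i - k j) *m D j.
  rewrite mulmx_exprD; congr (_ *m _ ^+ _).
  by rewrite -subn1 -[in LHS](subnK le_ji) -addnBA // subn1.
apply: submxMr.
have sZj : (Z' i *m P^T ^+ (k i - k j) <= Z j)%MS.
  apply/sub_kermxP; rewrite mulmx_exprD subnK //.
  by case/submxP: sZ => E ->; rewrite -mulmxA mulmx_ker mulmx0.
rewrite {2}/Z'; case: eqP => // kj_lam; rewrite sub_capmx sZj; apply/sub_kermxP.
rewrite mulmxA mulmx_exprD; have -> : (k i - k j + (k j).-1 = (k i).-1)%N.
  by rewrite -subn1 addnBA // subnK // subn1.
rewrite /Z'; have [ki_lam|neq] := eqVneq (k i) lam.
  by rewrite -mulmxA (sub_kermxP (capmxSr _ _)).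
(* A block longer than [lam] meets the extra condition automatically, since [alpha *m P ^+ (k i).-1]
   is zero. *)
have lel : (lam <= (k i).-1)%N by rewrite -ltnS prednK // ltn_neqAle eq_sym neq -kj_lam.
rewrite -mulmxA -trmx_expr -trmx_mul -(subnKC lel) exprD mulmxA alphaP mul0mx.
by rewrite trmx0 mulmx0.
Qed.

Lemma card_low_intertwiners :
  #|[set X in surj_intertwiners | (x *m X <= Q ^+ lam)%MS]|%:R
  = \prod_(i < r) (#|F|%:R ^+ (\sum_(1 <= j < k i) soc_rank P j)
       * (#|F|%:R ^+ (soc_rank P (k i) - (k i == lam)) - #|F|%:R ^+ i)) :> rat.
Proof.
have row_killP X (i : 'I_r) : P *m X = X *m Q -> k i = lam ->
    (row i (rows_of_inter X) *m (D i *m alpha^T) == 0) = (x *m X *m c i == 0).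
  move=> comX kl; rewrite rowK /D kl -trmx_expr -!trmx_mul trmx_eq0.
  by rewrite !mulmxA.
have sZ' W (i : 'I_r) : (row i W <= Z' i)%MS
    = (row i W <= Z i)%MS && ((k i == lam) ==> (row i W *m (D i *m alpha^T) == 0)).
  by rewrite /Z'; case: eqP => _; rewrite ?andbT // sub_capmx sub_kermx.
have -> : [set X in surj_intertwiners | (x *m X <= Q ^+ lam)%MS]
          = inter_of_rows @: free_images Z' D r.
  apply/setP=> X; apply/idP/imsetP=> [|[W]].
    rewrite !inE => /andP[/andP[/eqP comX fullX]].
    rewrite intertwiner_low_height // => /forallP xc; exists (rows_of_inter X).
      rewrite inE -row_full_inter // fullX /=; apply/forallP=> i.
      rewrite sZ' row_of_inter_ker //=; apply/implyP=> /eqP kl.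
      by rewrite row_killP //; have := xc i; rewrite kl eqxx.
    by rewrite rows_of_interK.
  rewrite !inE => /andP[freeW /forallP sW] ->.
  have comX : P *m inter_of_rows W = inter_of_rows W *m Q.
    by apply: inter_of_rows_comm => i; have := sW i; rewrite sZ' => /andP[].
  rewrite comX eqxx row_full_inter // inter_of_rowsK freeW /=.
  rewrite intertwiner_low_height //; apply/forallP=> i; apply/implyP=> /eqP kl.
  rewrite -row_killP // inter_of_rowsK.
  by have := sW i; rewrite sZ' kl eqxx => /andP[].
rewrite card_imset; last exact: can_inj inter_of_rowsK.
rewrite card_free_images => [|i lti].
  by apply: eq_bigr => i _; rewrite Z'_dom ?Z'_img ?k_gt0.
apply: Z'_nested; case: jQ => _ kS _ _.
by rewrite k_gt0 // kS // leqnSn lti.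
Qed.

End Height.

End Intertwiners.

(** The automorphism is [1 + eta], where [eta] is an intertwiner moving the first socle vector by
    the difference of the two. It is injective on the kernel of [T], hence everywhere as [T] is
    nilpotent. *)
Lemma height_transitive (F : fieldType) (d N lam : nat) (T : 'M[F]_d) (z z' : 'rV_d) :
    T ^+ N = 0 -> (0 < lam)%N -> z *m T ^+ lam = 0 -> z' *m T ^+ lam = 0 ->
    ~~ (z *m T ^+ lam.-1 <= T ^+ lam)%MS -> ~~ (z' *m T ^+ lam.-1 <= T ^+ lam)%MS ->
  exists phi : 'M_d, [/\ T *m phi = phi *m T, row_full phi
    & z *m T ^+ lam.-1 *m phi = z' *m T ^+ lam.-1].
Proof.
move=> nilT lam_gt0 zT z'T.
set y := z *m _; set y' := z' *m _; move=> ny ny'.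
(* Take one functional nonzero on each vector: one of the two, or else their sum, is nonzero on
   both. *)
have [h Th [yh y'h]] : exists2 h : 'cV_d, T ^+ lam *m h = 0 & y *m h != 0 /\ y' *m h != 0.
  have sep (v : 'rV_d) : ~~ (v <= T ^+ lam)%MS -> exists2 h : 'cV_d, T ^+ lam *m h = 0 & v *m h != 0.
    rewrite submxE => /rV0Pn[j vj]; exists (col j (cokermx (T ^+ lam))).
      by rewrite colE mulmxA mulmx_coker mul0mx.
    apply: contra vj; rewrite colE mulmxA -colE => /eqP/colP/(_ 0).
    by rewrite !mxE => /eqP.
  have [h1 Th1 yh1] := sep _ ny; have [h2 Th2 yh2] := sep _ ny'.
  have [y'h1|] := eqVneq (y' *m h1) 0; last by exists h1.
  have [yh2'|] := eqVneq (y *m h2) 0; last by exists h2.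
  exists (h1 + h2); rewrite !mulmxDr ?Th1 ?Th2 ?addr0 //.
  by rewrite yh2' y'h1 addr0 add0r.
pose a := (y *m h) 0 0; pose b := (y' *m h) 0 0.
have a0 : a != 0 by apply: contra yh; rewrite [y *m h]mx11_scalar -/a => /eqP->; rewrite raddf0.
have b0 : b != 0 by apply: contra y'h; rewrite [y' *m h]mx11_scalar -/b => /eqP->; rewrite raddf0.
(* The scalar makes [eta] send [y], whose pairing with [h] is [a], exactly to [y' - y]. *)
pose w := a^-1 *: (z' - z).
have wT : w *m T ^+ lam = 0 by rewrite -scalemxAl mulmxBl zT z'T subrr scaler0.
have wTl : w *m T ^+ lam.-1 = a^-1 *: (y' - y) by rewrite -scalemxAl mulmxBl.
(* [eta] is the intertwiner sending a generator dual to [h] to [w]; on vectors killed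
   by [T] it is [v |-> (v *m h) *: (w *m T ^+ lam.-1)]. *)
pose eta := \sum_(j < lam) T ^+ (lam - j.+1) *m h *m (w *m T ^+ j).
have Teta : T *m eta = eta *m T := shift_sum_intertwine Th wT.
have socE v : v *m T = 0 -> v *m eta = ((v *m h) 0 0 / a) *: (y' - y).
  move=> vT; rewrite mulmx_sumr; case: (lam) lam_gt0 wTl => // m _ wTm.
  rewrite big_ord_recr big1 => [|j _] /=.
    rewrite subnn expr0 mul1mx mulmxA wTm {1}[v *m h]mx11_scalar mul_scalar_mx.
    by rewrite scalerA add0r.
  rewrite !mulmxA subSS; have [n ->] : exists n, (m - j = n.+1)%N.
    by exists (m - j).-1; rewrite prednK ?subn_gt0.
  by rewrite exprS mulmxA vT !mul0mx.
have comm : T *m (1%:M + eta) = (1%:M + eta) *m T.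
  by rewrite mulmxDr mulmxDl mulmx1 mul1mx Teta.
have yT : y *m T = 0 by rewrite /y -mulmxA mulmxE -exprSr prednK.
exists (1%:M + eta); split=> //; last first.
  by rewrite mulmxDr mulmx1 socE // divff // scale1r addrC subrK.
rewrite row_full_unit -row_free_unit; apply: inj_row_free => v.
suff inj m : forall v : 'rV_d, v *m T ^+ m = 0 -> v *m (1%:M + eta) = 0 -> v = 0.
  by apply: (inj N); rewrite nilT mulmx0.
elim: m => {v} [|m IHm] v vTm v0; first by rewrite -[v]mulmx1 -vTm expr0.
have vT : v *m T = 0.
  apply: IHm; first by rewrite -mulmxA mulmxE -exprS.
  by rewrite -mulmxA comm mulmxA v0 mul0mx.
move: v0; rewrite mulmxDr mulmx1 socE //; set s := (v *m h) 0 0 => v0.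
suff s0 : s = 0 by move: v0; rewrite s0 mul0r scale0r addr0.
(* Pairing with [h] turns the relation into [s * b / a = 0]. *)
have := congr1 (fun M : 'rV_d => M *m h) v0.
rewrite mul0mx mulmxDl -scalemxAl mulmxBl [y *m h]mx11_scalar -/a.
rewrite [y' *m h]mx11_scalar -/b [v *m h]mx11_scalar -/s => /matrixP/(_ 0 0).
rewrite !mxE eqxx !mulr1n mulrBr divfK // addrC subrK => /eqP.
by rewrite !mulf_eq0 invr_eq0 (negPf a0) (negPf b0) !orbF => /eqP.
Qed.

Lemma rowg_ker_mulmx_unit (F : finFieldType) (e d : nat) (X : 'M[F]_(e, d)) (Y : 'M[F]_d) :
  Y \in unitmx -> rowg (kermx (X *m Y)) = rowg (kermx X).
Proof.
move=> uY; apply/setP=> v; rewrite !inE !sub_kermx mulmxA.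
apply/eqP/eqP => [vXY|->]; last by rewrite mul0mx.
by rewrite -[v *m X](mulmxK uY) vXY mul0mx.
Qed.

(** * From intertwiners to their kernels *)

Section KernelCount.

Variables (F : finFieldType) (e d : nat) (P : 'M[F]_e) (Q : 'M[F]_d).
Variables (x : 'rV[F]_e) (lam : nat).

Definition high_intertwiners : {set 'M[F]_(e, d)} :=
  [set X in surj_intertwiners P Q | ~~ (x *m X <= Q ^+ lam)%MS].

(** Two surjections with the same kernel differ by a unique automorphism of the target, so each
    kernel arises from as many intertwiners as there are automorphisms. *)
Lemma card_high_intertwiners :
  #|high_intertwiners|
  = (#|[set rowg (kermx X) | X in high_intertwiners]| * #|surj_intertwiners Q Q|)%N.
Proof.
rewrite -sum1_card (partition_big_imset (fun X => rowg (kermx X))) /=.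
rewrite -sum_nat_const; apply: eq_bigr => _ /imsetP[X hX ->].
have := hX; rewrite !inE => /andP[/andP[/eqP comX fullX] hx].
have injX : injective (mulmx X : 'M_d -> 'M_(e, d)).
  by apply: (can_inj (g := mulmx (pinvmx X))) => Y; rewrite mulmxA mulVpmx ?mul1mx.
rewrite -(card_imset _ injX) -sum1_card; apply: eq_bigl => X'.
apply/andP/imsetP=> [[hX' /eqP eqK]|[Y]].
  have := hX'; rewrite !inE => /andP[/andP[/eqP comX' fullX'] hx'].
  have XY : X *m (pinvmx X *m X') = X'.
    apply/eqP; rewrite mulmxA -subr_eq0 -{2}[X']mul1mx -mulmxBl; apply/eqP/sub_kermxP.
    apply/row_subP=> i; rewrite -mem_rowg eqK mem_rowg; apply: submx_trans (row_sub _ _) _.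
    by apply/sub_kermxP; rewrite mulmxBl mul1mx -mulmxA mulVpmx ?mulmx1 ?subrr.
  exists (pinvmx X *m X') => //; rewrite inE; apply/andP; split; last first.
    by rewrite -sub1mx (submx_trans _ (submxMl X _)) // XY sub1mx.
  by apply/eqP/injX; rewrite [LHS]mulmxA -comX -mulmxA XY comX' [RHS]mulmxA XY.
rewrite inE => /andP[/eqP comY fullY] ->.
have uY : Y \in unitmx by rewrite -row_full_unit.
have comX' : P *m (X *m Y) = X *m Y *m Q by rewrite mulmxA comX -!mulmxA comY.
split; last by rewrite rowg_ker_mulmx_unit.
have freeY : row_free Y by rewrite row_free_unit.
have fullXY : row_full (X *m Y) by rewrite /row_full mxrankMfree.
rewrite !inE comX' eqxx fullXY /=; apply: contra hx; rewrite mulmxA => /submxP[E eqE].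
(* The inverse also commutes with [Q], so it preserves the image of [Q ^+ lam]; hence composing with
   [Y] keeps the height condition. *)
have comV : Q *m invmx Y = invmx Y *m Q.
  by rewrite -[LHS](mulKmx uY) [Y *m _]mulmxA -comY mulmxK.
rewrite -(mulmxK uY (x *m X)) eqE -mulmxA (intertwine_expr _ comV).
by rewrite mulmxA submxMl.
Qed.

End KernelCount.

Lemma card_split_pred (T : finType) (S : {set T}) (P : pred T) :
  #|S| = (#|[set x in S | P x]| + #|[set x in S | ~~ P x]|)%N.
Proof.
rewrite -(cardsID [set x | P x] S); congr (_ + _)%N.
  by apply: eq_card => x; rewrite !inE.
by apply: eq_card => x; rewrite !inE andbC.
Qed.

Lemma soc_rank_anti (F : fieldType) (d : nat) (Q : 'M[F]_d) (t : nat) :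
  (0 < t)%N -> (soc_rank Q t.+1 <= soc_rank Q t)%N.
Proof.
case: t => // t _; apply/mxrankS/capmxS => //.
by rewrite /= exprS -mulmxE submxMl.
Qed.

Lemma soc_rank_jordan (F : fieldType) (d r : nat) (Q : 'M[F]_d) k u c t :
  jordan_system Q r k u c -> soc_rank Q t = num_blocks r k t.
Proof.
move=> jQ; case: t => [|t]; last by rewrite /soc_rank (rank_jordan_socle jQ).
rewrite -[LHS]/(soc_rank Q 1) /soc_rank (rank_jordan_socle jQ) //.
by apply: eq_bigr => i _; case: jQ => ->.
Qed.

Lemma jordan_bound (F : fieldType) (d r N : nat) (Q : 'M[F]_d) k u c i :
  jordan_system Q r k u c -> Q ^+ N = 0 -> (i < r)%N -> (0 < k i <= N)%N.
Proof.
case=> k_gt0 _ ucE _ nilQ lti; rewrite k_gt0 // leqNgt; apply/negP=> ltN.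
have := ucE i i (k i).-1 lti lti; rewrite prednK ?k_gt0 // !eqxx /=.
have leN : (N <= (k i).-1)%N by rewrite -ltnS prednK ?k_gt0.
rewrite -(subnK leN) exprD nilQ mulr0 mulmx0 mul0mx => /matrixP/(_ 0 0).
by rewrite !mxE eqxx => /eqP; rewrite eq_sym oner_eq0.
Qed.

(** This is [intertwiner_low_height] for the identity intertwiner. *)
Lemma jordan_has_block (F : finFieldType) (d r lam : nat) (Q : 'M[F]_d) k u c (g : 'rV_d) :
    jordan_system Q r k u c -> (0 < lam)%N -> g *m Q ^+ lam = 0 ->
    ~~ (g *m Q ^+ lam.-1 <= Q ^+ lam)%MS ->
  exists2 i, (i < r)%N & k i = lam.
Proof.
move=> jQ lam_gt0 gQ; have com1 : Q *m 1%:M = 1%:M *m Q by rewrite mulmx1 mul1mx.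
have := intertwiner_low_height jQ lam_gt0 gQ com1; rewrite mulmx1 => -> /forallPn[i].
by rewrite negb_imply => /andP[/eqP ki _]; exists i.
Qed.

(** * Gaussian binomials *)

Section GaussBinomial.

Variable p : nat.
Hypothesis p_gt1 : (1 < p)%N.
Local Notation q := (p%:R : rat).

Lemma expr_diff_eq0 (i j : nat) : (q ^+ i - q ^+ j == 0) = (i == j).
Proof. by rewrite subr_eq0 -!natrX eqr_nat eqn_exp2l. Qed.

Lemma prod_diff_expr (a b m : nat) : (b <= m)%N -> (m <= a)%N ->
  \prod_(b <= i < m) (q ^+ a - q ^+ i)
  = (\prod_(0 <= i < m - b) q ^+ (b + i)) * \prod_(0 <= i < m - b) (q ^+ (a - b - i) - 1).
Proof.
move=> le_bm le_ma; rewrite -{1}[b]add0n big_addn -big_split /=.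
rewrite !big_mkord; apply: eq_bigr => i _; rewrite mulrBr mulr1 -exprD [(i + b)%N]addnC.
congr (q ^+ _ - _); rewrite -subnDA subnKC // (leq_trans _ le_ma) //.
by rewrite -leq_subRL // ltnW ?ltn_ord.
Qed.

(** Both products share the same powers of [q]; what remains is the numerator and the denominator of
    the binomial. If [a < m], the factor of index [a] vanishes, as does the binomial. *)
Lemma gauss_binomial_prod (a b m : nat) : (b <= m)%N -> (b <= a)%N ->
  gauss_binomial p (a%:Z - b%:Z) (m%:Z - b%:Z) * \prod_(b <= i < m) (q ^+ m - q ^+ i)
  = \prod_(b <= i < m) (q ^+ a - q ^+ i).
Proof.
move=> le_bm le_ba; rewrite /gauss_binomial !subzn // !lez_nat leq0n /=.
have [le_ma|lt_am] := leqP (m - b) (a - b); last first.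
  rewrite mul0r; have lt : (a < m)%N by rewrite -(subnK le_ba) -(subnK le_bm) ltn_add2r.
  by rewrite (big_cat_nat (n := a)) ?(ltnW lt) //= [X in _ * X]big_ltn // subrr mul0r mulr0.
have le : (m <= a)%N by rewrite -(subnK le_ba) -(subnK le_bm) leq_add2r.
rewrite !prod_diff_expr //.
have -> : \prod_(0 <= i < m - b) (q ^+ (m - b - i) - 1)
        = \prod_(1 <= i < (m - b).+1) (q ^+ i - 1).
  rewrite big_nat_rev /= add0n [RHS]big_add1 /=; apply: eq_big_nat => i /andP[_ lti].
  by rewrite subKn.
rewrite mulrCA divfK // prodf_seq_neq0; apply/allP=> i; rewrite mem_index_iota /=.
case/andP=> i0 _; by rewrite -[1](expr0 q) expr_diff_eq0 -lt0n.
Qed.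

End GaussBinomial.

(** * Products over blocks regrouped by block size *)

Section CountFormula.

Variables (r N : nat) (k : nat -> nat).
Hypothesis kS : forall i j, (i <= j < r)%N -> (k j <= k i)%N.
Hypothesis k_bounds : forall i, (i < r)%N -> (0 < k i <= N)%N.
Local Notation m := (num_blocks r k).

Lemma num_blocks_anti t : (m t.+1 <= m t)%N.
Proof. by apply: leq_sum => i _; case: ltngtP. Qed.

Lemma num_blocks_range t i : (i < r)%N -> (m t.+1 <= i < m t)%N = (k i == t).
Proof.
move=> lti; by rewrite leqNgt !(ltn_num_blocks _ kS lti) -leqNgt eqn_leq.
Qed.

Lemma num_blocks_big : m N.+1 = 0%N.
Proof.
by apply: big1 => i _; case/andP: (k_bounds (ltn_ord i)) => _; rewrite ltnNge => ->.
Qed.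

(** By monotonicity, the blocks of size [t] occupy exactly the indices from [m t.+1] up to [m t],
    excluded. *)
Lemma regroup_blocks (R : comPzRingType) (f : nat -> nat -> R) :
  \prod_(i < r) f (k i) i
  = \prod_(1 <= t < N.+1) \prod_(m t.+1 <= i < m t) f t i.
Proof.
under [RHS]eq_bigr => t _.
  rewrite big_geq_mkord (big_ord_widen_cond r (fun i => m t.+1 <= i)%N (f t)) //=;
    last exact: num_blocks_le.
  under eq_bigl => i do rewrite num_blocks_range //.
  rewrite big_mkcond /=.
  over.
rewrite exchange_big /=; apply: eq_bigr => i _; rewrite -big_mkcond /=.
have ki : k i \in index_iota 1 N.+1.
  by rewrite mem_index_iota ltnS k_bounds.
rewrite (eq_bigl (pred1 (k i))) => [|t]; last by rewrite /= eq_sym.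
by rewrite -big_filter filter_pred1_uniq ?iota_uniq // big_seq1.
Qed.

(** Here [a] and [m] stand for the layer dimensions of the two modules, and [cnt] is recovered as
    [(surj - low) / aut]. If some [m t] exceeds [a t], there is no surjection and both sides
    vanish. *)
Lemma count_formula (p lam cnt surj low aut : nat) (a : nat -> nat) :
    (1 < p)%N -> (0 < lam <= N)%N -> (exists2 i, (i < r)%N & k i = lam) ->
    (forall t, (0 < t)%N -> (a t.+1 <= a t)%N) ->
    surj%:R = \prod_(i < r) (p%:R ^+ (\sum_(1 <= j < k i) a j)
                             * (p%:R ^+ a (k i) - p%:R ^+ i)) :> rat ->
    low%:R = \prod_(i < r) (p%:R ^+ (\sum_(1 <= j < k i) a j)
               * (p%:R ^+ (a (k i) - (k i == lam)) - p%:R ^+ i)) :> rat ->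
    aut%:R = \prod_(i < r) (p%:R ^+ (\sum_(1 <= j < k i) m j)
                            * (p%:R ^+ m (k i) - p%:R ^+ i)) :> rat ->
    surj = (low + cnt * aut)%N ->
  cnt%:R =
    (gauss_binomial p ((a lam)%:Z - (m lam.+1)%:Z) ((m lam)%:Z - (m lam.+1)%:Z)
     - gauss_binomial p ((a lam)%:Z - (m lam.+1)%:Z - 1)
                        ((m lam)%:Z - (m lam.+1)%:Z))
    * (\prod_(1 <= i < N.+1 | i != lam)
         gauss_binomial p ((a i)%:Z - (m i.+1)%:Z) ((m i)%:Z - (m i.+1)%:Z))
    * (\prod_(1 <= i < N.+1)
         (p%:R ^ (\sum_(1 <= j < i) (a j)%:Z) / p%:R ^ (\sum_(1 <= j < i) (m j)%:Z))
           ^ ((m i)%:Z - (m i.+1)%:Z)) :> rat.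
Proof.
move=> p_gt1 lam_bounds [il lt_il kil] aS surjE lowE autE eq_surj.
have p0 : p%:R != 0 :> rat by rewrite pnatr_eq0 -lt0n ltnW.
have aut0 : aut%:R != 0 :> rat.
  rewrite autE prodf_seq_neq0; apply/allP=> i _ /=.
  rewrite mulf_neq0 ?expf_neq0 // expr_diff_eq0 // gtn_eqF //.
  by rewrite (ltn_num_blocks _ kS).
have lt_m : (m lam.+1 < m lam)%N.
  have := num_blocks_range lam lt_il; rewrite kil eqxx => /andP[].
  exact: leq_ltn_trans.
have sumZ (b : nat -> nat) t :
    \sum_(1 <= j < t) (b j)%:Z = (\sum_(1 <= j < t) b j)%N%:Z.
  by rewrite -[RHS]natz natr_sum; apply: eq_bigr => j _; rewrite natz.
case: (boolP [forall t : 'I_N.+1, (0 < t)%N ==> (m t <= a t)%N]) => [/forallP le_ma | bad].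
  have{}le_ma t : (0 < t <= N)%N -> (m t <= a t)%N.
    case/andP=> t0 tN; have := le_ma (Ordinal (tN : (t < N.+1)%N)).
    by move/implyP; apply.
  have le_m'a t : (0 < t <= N)%N -> (m t.+1 <= a t)%N.
    by move=> tb; apply: leq_trans (num_blocks_anti t) (le_ma t tb).
  apply: (mulIf aut0).
  have -> : cnt%:R * aut%:R = surj%:R - low%:R :> rat.
    by rewrite eq_surj natrD natrM addrAC subrr add0r.
  rewrite surjE lowE autE !big_split /= -mulrBr.
  have powE (b : nat -> nat) : \prod_(i < r) p%:R ^+ (\sum_(1 <= j < k i) b j)
      = \prod_(1 <= t < N.+1) (p%:R ^ (\sum_(1 <= j < t) (b j)%:Z))
                               ^ ((m t)%:Z - (m t.+1)%:Z) :> rat.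
    rewrite (regroup_blocks (fun t _ => p%:R ^+ (\sum_(1 <= j < t) b j))).
    apply: eq_bigr => t _; rewrite prodr_const_nat sumZ subzn ?num_blocks_anti //.
  rewrite !powE.
  rewrite (regroup_blocks (fun t i => p%:R ^+ a t - p%:R ^+ i)).
  rewrite (regroup_blocks (fun t i => p%:R ^+ (a t - (t == lam)) - p%:R ^+ i)).
  rewrite (regroup_blocks (fun t i => p%:R ^+ m t - p%:R ^+ i)).
  have lam_iota : lam \in index_iota 1 N.+1 by rewrite mem_index_iota ltnS.
  have split_lam (f : nat -> rat) : \prod_(1 <= t < N.+1) f t
      = f lam * \prod_(1 <= t < N.+1 | t != lam) f t.
    by rewrite (bigD1_seq lam) ?iota_uniq.
  rewrite !(split_lam (fun t => \prod_(m t.+1 <= i < m t) _)) eqxx.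
  set PM := \prod_(m lam.+1 <= i < m lam) (p%:R ^+ m lam - p%:R ^+ i).
  set PA := \prod_(m lam.+1 <= i < m lam) (p%:R ^+ a lam - p%:R ^+ i).
  set PA' := \prod_(m lam.+1 <= i < m lam) _.
  (* Strictness ensures that the truncated [a lam - 1] is a true difference and is still at least
     [m lam.+1]. *)
  have lt_a : (m lam.+1 < a lam)%N by apply: leq_trans lt_m (le_ma _ _).
  have a_lam : (m lam.+1 <= a lam - 1)%N.
    by rewrite subn1 -ltnS prednK ?(leq_ltn_trans _ lt_a).
  have gaussA := gauss_binomial_prod p_gt1 (ltnW lt_m) (ltnW lt_a).
  have gaussA' := gauss_binomial_prod p_gt1 (ltnW lt_m) a_lam.
  have subA : (a lam - 1)%N%:Z - (m lam.+1)%:Z = (a lam)%:Z - (m lam.+1)%:Z - 1.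
    by rewrite -subzn ?(leq_ltn_trans _ lt_a) // addrAC.
  rewrite subA in gaussA'.
  rewrite -[PA]gaussA -[PA']gaussA'.
  have restA : \prod_(1 <= t < N.+1 | t != lam) \prod_(m t.+1 <= i < m t)
                 (p%:R ^+ (a t - (t == lam)) - p%:R ^+ i)
      = \prod_(1 <= t < N.+1 | t != lam) \prod_(m t.+1 <= i < m t)
                 (p%:R ^+ a t - p%:R ^+ i) :> rat.
    by apply: eq_bigr => t /negPf->; rewrite subn0.
  have gaussR : \prod_(1 <= t < N.+1 | t != lam) \prod_(m t.+1 <= i < m t)
                 (p%:R ^+ a t - p%:R ^+ i)
      = \prod_(1 <= t < N.+1 | t != lam)
          gauss_binomial p ((a t)%:Z - (m t.+1)%:Z) ((m t)%:Z - (m t.+1)%:Z)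
        * \prod_(1 <= t < N.+1 | t != lam) \prod_(m t.+1 <= i < m t)
                 (p%:R ^+ m t - p%:R ^+ i) :> rat.
    rewrite -big_split /= big_nat_cond [RHS]big_nat_cond.
    apply: eq_bigr => t /andP[/andP[t0 tN] _].
    by rewrite gauss_binomial_prod ?num_blocks_anti ?le_m'a ?t0.
  rewrite restA gaussR.
  have ratio : \prod_(1 <= t < N.+1) (p%:R ^ (\sum_(1 <= j < t) (a j)%:Z))
                               ^ ((m t)%:Z - (m t.+1)%:Z)
     = \prod_(1 <= i < N.+1)
         (p%:R ^ (\sum_(1 <= j < i) (a j)%:Z) / p%:R ^ (\sum_(1 <= j < i) (m j)%:Z))
           ^ ((m i)%:Z - (m i.+1)%:Z)
       * \prod_(1 <= t < N.+1) (p%:R ^ (\sum_(1 <= j < t) (m j)%:Z))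
                               ^ ((m t)%:Z - (m t.+1)%:Z) :> rat.
    rewrite -big_split /=; apply: eq_bigr => t _.
    by rewrite -expfzMl divfK // expfz_neq0.
  rewrite ratio -/PM; ring.
move: bad; rewrite negb_forall => /existsP bad.
have exbad : exists t, (0 < t <= N)%N && (a t < m t)%N.
  case: bad => t; rewrite negb_imply -ltnNge => /andP[t0 lt]; exists t.
  by rewrite t0 lt -ltnS ltn_ord.
have ubad t : (0 < t <= N)%N && (a t < m t)%N -> (t <= N)%N by case/andP=> /andP[].
(* For the largest such [t], [m t.+1 <= a t < m t]: the block of index [a t] has size [t], and its
   factor in [surj] is zero. *)
case: (ex_maxnP exbad ubad) => t /andP[tb lt_am] maxt.
have surj0 : surj = 0%N.
  have le_m'a : (m t.+1 <= a t)%N.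
    case/andP: tb => t0 tN; have [tN1|Nt] := ltnP t N; last first.
      have -> : t = N by apply/eqP; rewrite eqn_leq tN.
      by rewrite num_blocks_big.
    apply: leq_trans (aS t t0); rewrite leqNgt; apply/negP=> lt.
    by have := maxt t.+1; rewrite lt tN1 ltnn => /(_ isT).
  have lt_r : (a t < r)%N := leq_trans lt_am (num_blocks_le r k t).
  have kt : k (a t) = t by apply/eqP; rewrite -num_blocks_range // le_m'a.
  apply/eqP; rewrite -(eqr_nat rat) surjE (bigD1 (Ordinal lt_r)) //= kt subrr.
  by rewrite mulr0 mul0r.
have -> : cnt = 0%N.
  move/eqP: eq_surj; rewrite surj0 eq_sym addn_eq0 muln_eq0 => /andP[_ /orP[/eqP //|]].
  by move/eqP=> aut_0; rewrite aut_0 eqxx in aut0.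
(* The cases [x = 0] and [x = -1] cover both binomials of the bracket when [t = lam]. *)
have gauss0 (x : int) : x <= 0 ->
    gauss_binomial p ((a t)%:Z - (m t.+1)%:Z + x) ((m t)%:Z - (m t.+1)%:Z) = 0.
  move=> x0; rewrite /gauss_binomial; case: ifP => // /andP[_ le].
  have := le_trans le (_ : _ <= (a t)%:Z - (m t.+1)%:Z).
  rewrite gerDl x0 lerD2r lez_nat leqNgt lt_am => /(_ isT).
  by [].
have [tl|tl] := eqVneq t lam.
  by rewrite -tl -[X in gauss_binomial p X _ - _]addr0 !gauss0 // subrr !mul0r.
have t_iota : t \in index_iota 1 N.+1 by rewrite mem_index_iota ltnS.
rewrite [X in _ * X * _](_ : _ = 0) ?mulr0 ?mul0r //; apply/eqP.
rewrite prodf_seq_eq0; apply/hasP; exists t => //=; rewrite tl /=.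
by rewrite -[X in gauss_binomial p X _]addr0 gauss0.
Qed.



End CountFormula.

(** * Maps between cyclic extensions *)

(** In characteristic [p], ['X ^+ (p ^ n) - 1] is [('X - 1) ^+ (p ^ n)]; cancel one factor ['X - 1]
    and evaluate at [S]. *)
Lemma geometric_sum_pchar (p n d : nat) (S : 'M['F_p]_d) : prime p ->
  \sum_(i < p ^ n) S ^+ i = (S - 1%:M) ^+ (p ^ n).-1.
Proof.
move=> p_pr; case: d S => [|d] S; first by rewrite flatmx0 [RHS]flatmx0.
have N_gt0 : (0 < p ^ n)%N by rewrite expn_gt0 prime_gt0.
have polyE : \sum_(i < p ^ n) 'X^i = ('X - 1) ^+ (p ^ n).-1 :> {poly 'F_p}.
  have nz : 'X - 1 != 0 :> {poly 'F_p} by rewrite -polyC1 polyXsubC_eq0.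
  apply: (mulfI nz); rewrite -subrX1 -exprS prednK //.
  have pP : p \in [pchar {poly 'F_p}] by rewrite pchar_poly pchar_Fp.
  have pnat : [pchar {poly 'F_p}].-nat (p ^ n)%N by rewrite pnatX pnatE ?pP.
  by rewrite exprDn_pchar // exprNn_pchar // expr1n.
have := congr1 (horner_mx S) polyE; rewrite rmorph_sum rmorphXn rmorphB /=.
rewrite horner_mx_X rmorph1 => <-; apply: eq_bigr => i _.
by rewrite rmorphXn /= horner_mx_X.
Qed.

Section CyclicExtMaps.

Variables (p dA dM : nat) (DA : cyclic_ext p dA) (DM : cyclic_ext p dM).
Hypothesis eq_ord : ce_ord DA = ce_ord DM.
Local Notation N := (ce_ord DM).

Definition ce_map (X : 'M['F_p]_(dA, dM)) (u : ce_group DA) : ce_group DM :=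
  (ce_ordinal DM u.1, u.2 *m X).

Lemma ce_map_fst X u : (ce_map X u).1 = u.1 :> nat.
Proof. by rewrite /= modn_small // -eq_ord. Qed.

Lemma ce_mapM X : ce_act DA *m X = X *m ce_act DM -> ce_pow DA *m X = ce_pow DM ->
  {morph ce_map X : u v / (u * v)%g}.
Proof.
move=> comX powX [[i lti] b] [[j ltj] b']; rewrite !ce_mulE; apply: ce_eq => /=.
  by rewrite eq_ord modn_mod modnDm.
rewrite ![(_ %% N)%N]modn_small -?eq_ord // !mulmxDl -!mulmxA (intertwine_expr _ comX).
by rewrite -powX -!scaler_nat scalemxAl.
Qed.

Lemma ce_map_surj X : row_full X -> forall v, exists u, ce_map X u = v.
Proof.
move=> fullX [[i lti] b]; exists (ce_ordinal DA i, b *m pinvmx X); apply: ce_eq => /=.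
  by rewrite eq_ord modn_mod modn_small.
by rewrite -mulmxA mulVpmx ?mulmx1.
Qed.

Lemma ce_iota_inj p' d (D : cyclic_ext p' d) : injective (ce_iota D).
Proof. by move=> b b' []. Qed.

Lemma ce_iotaP p' d (D : cyclic_ext p' d) (u : ce_group D) :
  u.1 = 0%N :> nat -> u = ce_iota D u.2.
Proof. by move=> u1; apply: ce_eq => //=; rewrite mod0n. Qed.

Lemma ce_iota_conj p' d (D : cyclic_ext p' d) b b' :
  (ce_iota D b ^ ce_iota D b')%g = ce_iota D b.
Proof. by rewrite conjgE -ce_iotaD addrC ce_iotaD mulKg. Qed.

(** Each [iota c] moved right past a lift acquires one factor [ce_act D]; for [j] the order, the sum
    is the norm. *)
Lemma ce_lift_twist p' d (D : cyclic_ext p' d) c j :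
  ((ce_lift D * ce_iota D c) ^+ j)%g
  = (ce_lift D ^+ j * ce_iota D (c *m \sum_(i < j) ce_act D ^+ i))%g.
Proof.
elim: j => [|j IHj]; first by rewrite !expg0 big_ord0 mulmx0 mul1g.
have regroup (g a t b : ce_group D) : (g * a * (t * b) = g * t * (a ^ t * b))%g.
  by rewrite -[LHS]mulgA (mulgA a) (conjgC a) -(mulgA t) (mulgA g).
rewrite expgSr IHj regroup -expgSr ce_conj -ce_iotaD; congr (_ * ce_iota D _)%g.
rewrite big_ord_recl mulmxDr expr0 mulmx1 addrC; congr (_ + _).
rewrite -mulmxA mulmx_suml; congr (_ *m _); apply: eq_bigr => i _.
by rewrite mulmxE -exprSr.
Qed.

Variable theta : ce_group DA -> ce_group DM.
Hypothesis thetaM : {morph theta : u v / (u * v)%g}.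
Hypothesis theta_fst : forall u, (theta u).1 = u.1 :> nat.

Let theta_iota b : theta (ce_iota DA b) = ce_iota DM (theta (ce_iota DA b)).2.
Proof. by apply: ce_iotaP; rewrite theta_fst /= mod0n. Qed.

Definition ce_restr_mx : 'M['F_p]_(dA, dM) :=
  \matrix_(i < dA) (theta (ce_iota DA (delta_mx 0 i))).2.
Local Notation X := ce_restr_mx.

(** An additive map between spaces over the prime field is linear, every scalar being a multiple of
    1. *)
Lemma ce_restrE b : theta (ce_iota DA b) = ce_iota DM (b *m X).
Proof.
pose f b := (theta (ce_iota DA b)).2.
have fD : {morph f : b c / b + c}.
  move=> b1 b2; apply: (@ce_iota_inj _ _ DM).
  by rewrite ce_iotaD /f -!theta_iota ce_iotaD thetaM.
have f0 : f 0 = 0 by apply: (addrI (f 0)); rewrite -fD !addr0.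
have fn b1 j : f (b1 *+ j) = f b1 *+ j.
  by elim: j => [|j IHj]; rewrite ?mulr0n // !mulrS fD IHj.
have fZ a b1 : f (a *: b1) = a *: f b1.
  by rewrite -[a]natr_Zp !scaler_nat fn.
rewrite theta_iota; congr (ce_iota _ _); rewrite -/(f b) {1}(row_sum_delta b).
rewrite (big_morph f fD f0) mulmx_sum_row; apply: eq_bigr => i _.
by rewrite fZ rowK.
Qed.

Lemma ce_restr_lift : exists c, theta (ce_lift DA) = (ce_lift DM * ce_iota DM c)%g.
Proof.
exists (theta (ce_lift DA)).2; rewrite [LHS]ce_normal_form theta_fst /=.
by rewrite modn_small ?ce_ord_gt1 // expg1.
Qed.

(** The image of the lift is the lift times some [iota c], which acts trivially by conjugation on
    the abelian kernel. *)
Lemma ce_restr_intertwine : ce_act DA *m X = X *m ce_act DM.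
Proof.
apply/row_matrixP=> i; rewrite !rowE; apply: (@ce_iota_inj _ _ DM).
have [c thetat] := ce_restr_lift.
have thetaJ u v : theta (u ^ v)%g = (theta u ^ theta v)%g.
  by apply: (mulgI (theta v)); rewrite -conjgC -!thetaM -conjgC.
rewrite mulmxA -ce_restrE -ce_conj thetaJ thetat ce_restrE conjgM ce_conj.
by rewrite ce_iota_conj mulmxA.
Qed.

(** Changing the lift by [iota c] changes its [N]-th power by the norm of [c]. *)
Lemma ce_restr_pow : exists c,
  ce_pow DA *m X = ce_pow DM + c *m \sum_(i < N) ce_act DM ^+ i.
Proof.
have [c thetat] := ce_restr_lift; exists c; apply: (@ce_iota_inj _ _ DM).
have theta1 : theta 1%g = 1%g by apply: (mulgI (theta 1%g)); rewrite -thetaM !mulg1.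
have thetaX u j : theta (u ^+ j)%g = (theta u ^+ j)%g.
  by elim: j => [|j IHj]; rewrite ?expg0 // !expgS thetaM IHj.
rewrite -ce_restrE -ce_lift_pow thetaX thetat eq_ord ce_lift_twist ce_lift_pow.
by rewrite ce_iotaD.
Qed.

Lemma ce_restr_full : (forall v, exists u, theta u = v) -> row_full X.
Proof.
move=> surj; rewrite -sub1mx; apply/row_subP=> i; rewrite rowE mulmx1.
have [u thetau] := surj (ce_iota DM (delta_mx 0 i)).
have u1 : u.1 = 0%N :> nat by rewrite -theta_fst thetau /= mod0n.
move: thetau; rewrite (ce_iotaP u1) ce_restrE => /ce_iota_inj <-.
exact: submxMl.
Qed.

Lemma ce_restr_ker u : (theta u == 1%g) = (u \in ce_iota DA @: rowg (kermx X)).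
Proof.
have iota0 p' d (D : cyclic_ext p' d) : ce_iota D 0 = 1%g by [].
apply/eqP/imsetP=> [thetau | [b]].
  have u1 : u.1 = 0%N :> nat by rewrite -theta_fst thetau /= mod0n.
  exists u.2; last exact: ce_iotaP.
  rewrite inE sub_kermx; apply/eqP/(@ce_iota_inj _ _ DM).
  by rewrite -ce_restrE -(ce_iotaP u1) thetau iota0.
by rewrite inE sub_kermx => /eqP bX ->; rewrite ce_restrE bX iota0.
Qed.

End CyclicExtMaps.

(** * Intermediate fields *)

Section Correspondence.

Variables (F0 : fieldType) (Om : splittingFieldType F0).
Variables (F K E : {subfield Om}) (p n : nat) (sigma : gal_of K).
Hypotheses (p_pr : prime p) (genG : 'Gal(K / F)%g = <[sigma]>%g).
Hypothesis (oG : #|'Gal(K / F)%g| = (p ^ n)%N).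
Variables (lambda : nat) (lambda_bounds : (0 < lambda < p ^ n)%N).
Variables (dA : nat) (A : mx_representation 'F_p 'Gal(K / F)%G dA).
Variables (decA : cyclic_decomposition A) (iA : 'I_(cd_size decA)).
Hypothesis dim_iA : \rank (cyclic_mx A (cd_gen iA)) = lambda.
Variables (dM : nat) (M : mx_representation 'F_p 'Gal(K / F)%G dM).
Variables (decM : cyclic_decomposition M) (iM : 'I_(cd_size decM)).
Hypothesis dim_iM : \rank (cyclic_mx M (cd_gen iM)) = lambda.

Local Notation DA := (bullet p_pr genG oG lambda_bounds dim_iA).
Local Notation DM := (bullet p_pr genG oG lambda_bounds dim_iM).
Local Notation phiA := (bullet_proj_morphism p_pr genG oG lambda_bounds dim_iA).
Local Notation phiM := (bullet_proj_morphism p_pr genG oG lambda_bounds dim_iM).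
Local Notation TA := (A sigma - 1%:M).
Local Notation TM := (M sigma - 1%:M).
Local Notation xA := (bullet_pow sigma lambda iA).
Local Notation xM := (bullet_pow sigma lambda iM).

Hypotheses (sKE : (K <= E)%VS) (galFE : galois F E) (sFK : (F <= K)%VS).
Variable psi : {morphism 'Gal(E / F)%g >-> ce_group DA}.
Hypothesis isoE : isom 'Gal(E / F)%g [set: ce_group DA] psi.
Hypothesis psiK : forall x, x \in 'Gal(E / F)%g -> {in K, phiA (psi x) =1 x}.

Definition fiber_group (U : {set 'rV['F_p]_dA}) : {set gal_of E} :=
  [set g in 'Gal(E / F)%g | psi g \in ce_iota DA @: U].

Lemma in_fiber_group U g :
  (g \in fiber_group U) = (g \in 'Gal(E / F)%g) && (psi g \in ce_iota DA @: U).
Proof. by rewrite in_set. Qed.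

Definition kernel_field (U : {set 'rV['F_p]_dA}) : {subfield Om} :=
  [aspace of fixedField (fiber_group U)].

Local Notation high := (high_intertwiners TA TM xA lambda).

Let lam_gt0 : (0 < lambda)%N. Proof. by case/andP: lambda_bounds. Qed.
Let nilM : TM ^+ (p ^ n) = 0.
Proof. exact: unipotent_nilp p_pr (bullet_actX M genG oG). Qed.

Lemma gen_kill (d : nat) (V : mx_representation 'F_p 'Gal(K / F)%G d)
    (dV : cyclic_decomposition V) (i : 'I_(cd_size dV)) :
  \rank (cyclic_mx V (cd_gen i)) = lambda ->
  cd_gen i *m (V sigma - 1%:M) ^+ lambda = 0.
Proof.
move=> dim_i; have nilV : (V sigma - 1%:M) ^+ (p ^ n) = 0.
  exact: unipotent_nilp p_pr (bullet_actX V genG oG).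
by have [] := cyclic_mx_basis genG nilV (cd_gen i); rewrite dim_i.
Qed.

(** The functional [cd_cogen i] vanishes on the image of the [lambda]-th power but takes the value 1
    on this vector. *)
Lemma gen_height (d : nat) (V : mx_representation 'F_p 'Gal(K / F)%G d)
    (dV : cyclic_decomposition V) (i : 'I_(cd_size dV)) :
  \rank (cyclic_mx V (cd_gen i)) = lambda ->
  ~~ (cd_gen i *m (V sigma - 1%:M) ^+ lambda.-1 <= (V sigma - 1%:M) ^+ lambda)%MS.
Proof.
move=> dim_i; have nilV : (V sigma - 1%:M) ^+ (p ^ n) = 0.
  exact: unipotent_nilp p_pr (bullet_actX V genG oG).
apply/negP=> /submxP[z zE].
have := cd_cogenE genG nilV i i lambda.-1; rewrite dim_i prednK // !eqxx /= zE.
have := cd_cogen_kill genG nilV i; rewrite dim_i -mulmxA => ->.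
rewrite mulmx0 => /matrixP/(_ 0 0); rewrite !mxE eqxx /= => /eqP.
by rewrite eq_sym oner_eq0.
Qed.

(** The norm is [TM ^+ (p ^ n).-1] and [lambda < p ^ n]; so the choice of a lift does not affect the
    height condition. *)
Lemma twist_low (c : 'rV['F_p]_dM) :
  (c *m \sum_(i < p ^ n) M sigma ^+ i <= TM ^+ lambda)%MS.
Proof.
rewrite geometric_sum_pchar //; case/andP: lambda_bounds => _ lt_lam.
have le : (lambda <= (p ^ n).-1)%N by rewrite -ltnS prednK // (leq_trans _ lt_lam).
by rewrite -(subnK le) exprD mulmxA submxMl.
Qed.

Lemma fiber_groupP (Y : 'M['F_p]_dA) : group_set (fiber_group (rowg Y)).
Proof.
apply/group_setP; split=> [|g h].
  rewrite inE group1 morph1; apply/imsetP; exists 0 => //.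
  by rewrite mem_rowg sub0mx.
rewrite !inE => /andP[Gg /imsetP[b Ub psig]] /andP[Gh /imsetP[c Uc psih]].
rewrite groupM // morphM // psig psih -ce_iotaD; apply: imset_f.
by move: Ub Uc; rewrite !mem_rowg => Ub Uc; apply: addmx_sub.
Qed.

Lemma gal_kernel_field (Y : 'M['F_p]_dA) :
  'Gal(E / kernel_field (rowg Y))%g = fiber_group (rowg Y).
Proof. exact: (@gal_fixedField _ _ _ (Group (fiber_groupP Y))). Qed.

Lemma kernel_field_inj : {in [set rowg (kermx X) | X in high] &, injective kernel_field}.
Proof.
move=> _ _ /imsetP[X _ ->] /imsetP[X' _ ->] eqL.
have eqH : fiber_group (rowg (kermx X)) = fiber_group (rowg (kermx X')).
  have eqG := congr1 (fun L : {subfield Om} => 'Gal(E / L)%g) eqL.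
  exact: etrans (esym (gal_kernel_field _)) (etrans eqG (gal_kernel_field _)).
have [injp imp] := isomP isoE.
apply/setP=> b.
have [g Gg psig] : exists2 g, g \in 'Gal(E / F)%g & psi g = ce_iota DA b.
  have : ce_iota DA b \in (psi @* 'Gal(E / F))%g by rewrite imp inE.
  by case/morphimP=> g _ Gg ->; exists g.
have memb U : (g \in fiber_group U) = (b \in U).
  rewrite in_fiber_group Gg psig.
  exact: (mem_imset _ _ (@ce_iota_inj _ _ DA)).
have eqg := congr1 (fun H : {set _} => g \in H) eqH.
exact: etrans (esym (memb _)) (etrans eqg (memb _)).
Qed.

Let fst_inj (i j : nat) : (i < p ^ n)%N -> (j < p ^ n)%N ->
  (sigma ^+ i)%g = (sigma ^+ j)%g -> i = j.
Proof.
move=> lti ltj /eqP; rewrite eq_expg_mod_order orderE -genG oG.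
by rewrite !modn_small // => /eqP.
Qed.

(** Restriction to [L], read through [psi] and [psiL], is a surjection [theta] of bullet groups; [X]
    is its matrix on the abelian kernels, and its kernel corresponds to [Gal(E/L)]. *)
Lemma kernel_field_of_solution (L : {subfield Om}) :
    (L <= E)%VS -> solves F phiM L ->
  exists2 X, X \in high & L = kernel_field (rowg (kermx X)).
Proof.
move=> sLE [sKL galFL [psiL isoL psiLK]].
have [injE imE] := isomP isoE; have [injL imL] := isomP isoL.
have sFLE : (F <= L <= E)%VS by rewrite sLE (subv_trans sFK sKL).
have nFL : normalField F L by case/and3P: galFL.
pose res := normalField_cast_morphism sFLE nFL.
have resG g : g \in 'Gal(E / F)%g -> res g \in 'Gal(L / F)%g.
  by move=> Gg; rewrite -(normalField_img galFE sFLE nFL) mem_morphim.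
have res_surj h : h \in 'Gal(L / F)%g -> exists2 g, g \in 'Gal(E / F)%g & h = res g.
  rewrite -(normalField_img galFE sFLE nFL) => /morphimP[g _ Gg ->].
  by exists g.
pose theta u := psiL (res (invm injE u)).
have psi_surj u : exists2 g, g \in 'Gal(E / F)%g & u = psi g.
  have : u \in (psi @* 'Gal(E / F))%g by rewrite imE inE.
  by case/morphimP=> g _ Gg ->; exists g.
have theta_psi g : g \in 'Gal(E / F)%g -> theta (psi g) = psiL (res g).
  by move=> Gg; rewrite /theta invmE.
have thetaM : {morph theta : u v / (u * v)%g}.
  move=> u v; have [g Gg ->] := psi_surj u; have [h Gh ->] := psi_surj v.
  by rewrite -morphM // !theta_psi ?groupM // morphM // morphM ?resG.
(* Both solutions are compatible with restriction to [K], where powers of [sigma] determine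
   exponents below [p ^ n]. *)
have theta_fst u : (theta u).1 = u.1 :> nat.
  have [g Gg ->] := psi_surj u; rewrite theta_psi //.
  apply: fst_inj; rewrite ?ltn_ord //; apply/eqP/gal_eqP=> b Kb.
  transitivity (g b); last by rewrite -(psiK Gg Kb).
  rewrite -(normalField_cast_eq sFLE nFL Gg (subvP sKL _ Kb)).
  exact: psiLK (resG _ Gg) _ Kb.
have theta_surj v : exists u, theta u = v.
  have : v \in (psiL @* 'Gal(L / F))%g by rewrite imL inE.
  case/morphimP=> h _ /res_surj[g Gg ->] ->.
  by exists (psi g); rewrite theta_psi.
pose X := ce_restr_mx theta.
have eqN : ce_ord DA = ce_ord DM by [].
exists X.
  have comX : A sigma *m X = X *m M sigma := ce_restr_intertwine thetaM theta_fst.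
  rewrite !inE mulmxBl mulmxBr mul1mx mulmx1 comX eqxx /=; apply/andP; split.
    exact: ce_restr_full thetaM theta_fst theta_surj.
  have [c /= xAX] := ce_restr_pow eqN thetaM theta_fst.
  (* The images of [xA] and [xM] differ by a norm, so they are low together. *)
  apply: contra (gen_height dim_iM) => low.
  have -> : cd_gen iM *m TM ^+ lambda.-1
          = xA *m X - c *m \sum_(i < p ^ n) M sigma ^+ i.
    by rewrite xAX addrK.
  by rewrite addmx_sub ?eqmx_opp ?twist_low.
apply: val_inj; rewrite /=.
have -> : fiber_group (rowg (kermx X)) = 'Gal(E / L)%g.
  rewrite -(normalField_ker sFLE nFL); apply/setP=> g; rewrite in_fiber_group.
  rewrite -(ce_restr_ker thetaM theta_fst).
  apply/andP/idP=> [[Gg /eqP psi1]|Kg].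
    apply/(kerP res Gg)/(injmP injL); rewrite ?resG ?group1 //.
    by rewrite -theta_psi // psi1 morph1.
  have Gg : g \in 'Gal(E / F)%g := dom_ker Kg; split=> //.
  have res1 : res g = 1%g := mker Kg.
  by rewrite theta_psi // res1 morph1.
by apply/esym/galois_fixedField; apply: galoisS galFE.
Qed.

(** By [height_transitive], an automorphism of the target corrects [X] so that [xA] goes exactly to
    [xM], without changing the kernel. Then [ce_map] is a surjection of bullet groups, which induces
    the solution. *)
Lemma solution_of_intertwiner X : X \in high ->
  (kernel_field (rowg (kermx X)) <= E)%VS /\
  solves F phiM (kernel_field (rowg (kermx X))).
Proof.
rewrite !inE => /andP[/andP[/eqP comX fullX] hX].
have xAX j : cd_gen iA *m TA ^+ j *m X = cd_gen iA *m X *m TM ^+ j.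
  by rewrite -mulmxA (intertwine_expr _ comX) mulmxA.
have [phi [comphi fullphi phiE]] : exists phi : 'M_dM,
    [/\ TM *m phi = phi *m TM, row_full phi & xA *m X *m phi = xM].
  rewrite /bullet_pow xAX; apply: (height_transitive nilM lam_gt0).
  - by rewrite -xAX gen_kill // mul0mx.
  - exact: gen_kill.
  - by rewrite -xAX.
  exact: gen_height.
pose Y := X *m phi.
have uphi : phi \in unitmx by rewrite -row_full_unit.
rewrite -(rowg_ker_mulmx_unit X uphi) -/Y.
have fullY : row_full Y by rewrite /row_full mxrankMfree ?row_free_unit.
have comTY : TA *m Y = Y *m TM by rewrite /Y mulmxA comX -!mulmxA comphi.
have comY : A sigma *m Y = Y *m M sigma.
  rewrite -(subrK 1%:M (A sigma)) -(subrK 1%:M (M sigma)) mulmxDl mulmxDr comTY.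
  by rewrite mul1mx mulmx1.
have eqN : ce_ord DA = ce_ord DM by [].
pose theta := @ce_map _ _ _ DA DM Y.
have thetaM : {morph theta : u v / (u * v)%g}.
  by apply: ce_mapM => //=; rewrite /Y mulmxA phiE.
have theta_fst u : (theta u).1 = u.1 :> nat by apply: ce_map_fst.
have restrY : ce_restr_mx theta = Y.
  by apply/row_matrixP=> i; rewrite rowK /= rowE.
have theta_ker u : (theta u == 1%g) = (u \in ce_iota DA @: rowg (kermx Y)).
  by rewrite (ce_restr_ker thetaM theta_fst) restrY.
have [injE imE] := isomP isoE.
pose f g := theta (psi g).
have fM : {in 'Gal(E / F)%g &, {morph f : g h / (g * h)%g}}.
  by move=> g h Gg Gh; rewrite /f morphM // thetaM.
pose fm := Morphism fM.
have eqker : fiber_group (rowg (kermx Y)) = ('ker fm)%g.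
  apply/setP=> g; rewrite in_fiber_group.
  apply/andP/idP=> [[Gg]|Kg].
    by rewrite -theta_ker => /eqP fg; apply/kerP.
  have Gg : g \in 'Gal(E / F)%g := dom_ker Kg; split=> //.
  by rewrite -theta_ker; apply/eqP/(mker Kg).
set L := kernel_field _.
have sLE : (L <= E)%VS by apply: fixedField_bound.
split=> //.
have galEL : 'Gal(E / L)%g = ('ker fm)%g := etrans (gal_kernel_field _) eqker.
have galFL : galois F L.
  have eqL : (L : {vspace Om}) = fixedField ('ker fm)%g by rewrite -eqker.
  by rewrite eqL; apply: normal_fixedField_galois galFE _ (ker_normal fm).
(* Elements of the fiber group have [psi]-image in the kernel of the projection, hence fix [K]. *)
have sKL : (K <= L)%VS.
  rewrite -(galois_connection _ sKE); apply/subsetP=> g; rewrite in_fiber_group.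
  case/andP=> Gg /imsetP[b _ psig]; rewrite gal_kHom //; apply/kAHomP=> a Ka.
  by rewrite -(psiK Gg Ka) /= psig bullet_proj_iota gal_id.
have sFLE : (F <= L <= E)%VS by rewrite sLE (subv_trans sFK sKL).
have nFL : normalField F L by case/and3P: galFL.
pose res := normalField_cast_morphism sFLE nFL.
have res_im : (res @* 'Gal(E / F))%g = 'Gal(L / F)%g := normalField_img galFE sFLE nFL.
have res_surj h : h \in 'Gal(L / F)%g -> exists2 g, g \in 'Gal(E / F)%g & h = res g.
  by rewrite -res_im => /morphimP[g _ Gg ->]; exists g.
have res_ker : ('ker res)%g = ('ker fm)%g := etrans (normalField_ker sFLE nFL) galEL.
have sker : ('ker res \subset 'ker fm)%g by rewrite res_ker.
have sdom : 'Gal(L / F)%g \subset (res @* 'Gal(E / F))%g by rewrite res_im.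
(* Restriction to [L] and [f] have the same kernel, so [f] factors injectively through
   restriction. *)
pose psiL := restrm_morphism sdom (factm_morphism sker (subxx 'Gal(E / F)%g)).
have psiLE g : g \in 'Gal(E / F)%g -> psiL (res g) = f g by move=> Gg; apply: factmE.
split=> //; exists psiL.
  apply/isomP; split.
    apply/injmP=> _ _ /res_surj[g Gg ->] /res_surj[h Gh ->].
    rewrite !psiLE // => eqf; apply/(rcoset_kerP res Gg Gh); rewrite res_ker.
    exact/(rcoset_kerP fm Gg Gh).
  apply/setP=> v; rewrite !inE; have [u <-] := ce_map_surj eqN fullY v.
  have : u \in (psi @* 'Gal(E / F))%g by rewrite imE inE.
  case/morphimP=> g _ Gg ->; rewrite -[ce_map _ _ _]/(f g) -psiLE //.
  have Lg : res g \in 'Gal(L / F)%g by rewrite -res_im mem_morphim.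
  exact: (mem_morphim _ Lg Lg).
move=> _ /res_surj[g Gg ->] b Kb; rewrite psiLE //.
rewrite (normalField_cast_eq sFLE nFL Gg (subvP sKL _ Kb)) -(psiK Gg Kb).
by rewrite /= /bullet_proj theta_fst.
Qed.

End Correspondence.

Theorem theorem5p8 (F0 : fieldType) (Om : splittingFieldType F0)
    (F K E : {subfield Om}) (p n : nat) (sigma : gal_of K)
    (p_pr : prime p) (galKF : galois F K)
    (genG : 'Gal(K / F)%g = <[sigma]>%g) (oG : #|'Gal(K / F)%g| = (p ^ n)%N)
    (lambda : nat) (lambda_bounds : (0 < lambda < p ^ n)%N)
    (dA : nat) (A : mx_representation 'F_p 'Gal(K / F)%G dA)
    (decA : cyclic_decomposition A) (iA : 'I_(cd_size decA))
    (dim_iA : \rank (cyclic_mx A (cd_gen iA)) = lambda)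
    (dM : nat) (M : mx_representation 'F_p 'Gal(K / F)%G dM)
    (decM : cyclic_decomposition M) (iM : 'I_(cd_size decM))
    (dim_iM : \rank (cyclic_mx M (cd_gen iM)) = lambda)
    (solE : solves F (bullet_proj_morphism p_pr genG oG lambda_bounds dim_iA) E) :
  let a (i : nat) : int := (Delta A sigma i)%:Z in
  let m (i : nat) : int := (Delta M sigma i)%:Z in
  exists Ls : seq {subfield Om},
    [/\ uniq Ls,
        forall L : {subfield Om}, L \in Ls <->
          ((K <= L)%VS /\ (L <= E)%VS) /\
          solves F (bullet_proj_morphism p_pr genG oG lambda_bounds dim_iM) L
      & (size Ls)%:R =
          (gauss_binomial p (a lambda - m lambda.+1) (m lambda - m lambda.+1)
           - gauss_binomial p (a lambda - m lambda.+1 - 1)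
                              (m lambda - m lambda.+1))
          * (\prod_(1 <= i < (p ^ n).+1 | i != lambda)
               gauss_binomial p (a i - m i.+1) (m i - m i.+1))
          * (\prod_(1 <= i < (p ^ n).+1)
               (p%:R ^ (\sum_(1 <= j < i) a j) / p%:R ^ (\sum_(1 <= j < i) m j))
                 ^ (m i - m i.+1)) :> rat].

Proof.
move=> a m; have [sKE galFE [psi isoE psiK]] := solE.
have sFK : (F <= K)%VS by case/and3P: galKF.
have nilM := unipotent_nilp p_pr (bullet_actX M genG oG).
have [lam_gt0 lt_lam] := andP lambda_bounds.
pose high := high_intertwiners (A sigma - 1%:M) (M sigma - 1%:M)
               (bullet_pow sigma lambda iA) lambda.
pose Us := [set rowg (kermx X) | X in high].
exists [seq kernel_field psi U | U in Us]; split.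
- rewrite map_inj_in_uniq ?enum_uniq // => U U'; rewrite !mem_enum => UU UU'.
  exact: (kernel_field_inj isoE UU UU').
- move=> L; split=> [/mapP[U] | [[_ sLE] solL]].
    rewrite mem_enum => /imsetP[X hX ->] ->.
    have [sLE solL] := solution_of_intertwiner dim_iM sKE galFE sFK isoE psiK hX.
    by have [sKL _ _] := solL.
  have [X hX ->] := kernel_field_of_solution galFE sFK isoE psiK sLE solL.
  by apply/mapP; exists (rowg (kermx X)) => //; rewrite mem_enum; apply/imsetP; exists X.
rewrite size_map -cardE.
have [r [k [u [c jM]]]] := cd_jordan decM genG nilM.
have cardF : #|'F_p| = p by rewrite card_Fp.
have jbound i : (i < r)%N -> (0 < k i <= p ^ n)%N := jordan_bound jM nilM.
have kS : forall i j, (i <= j < r)%N -> (k j <= k i)%N by case: jM.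
have mE i : m i = (num_blocks r k i)%:Z.
  by rewrite /m /Delta (rank_rfix_cycle M genG) -(soc_rank_jordan _ jM).
have aE i : a i = (soc_rank (A sigma - 1%:M) i)%:Z.
  by rewrite /a /Delta (rank_rfix_cycle A genG).
have killA := gen_kill p_pr genG oG dim_iA.
have killM := gen_kill p_pr genG oG dim_iM.
have heightA := gen_height p_pr genG oG lambda_bounds dim_iA.
have heightM := gen_height p_pr genG oG lambda_bounds dim_iM.
have surjE := card_surj_intertwiners (A sigma - 1%:M) nilM jM.
have lowE := card_low_intertwiners nilM jM lam_gt0 killA heightA.
have autE := card_surj_intertwiners (M sigma - 1%:M) nilM jM.
rewrite cardF in surjE lowE autE.
have autE' : #|surj_intertwiners (M sigma - 1%:M) (M sigma - 1%:M)|%:R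
   = \prod_(i < r) (p%:R ^+ (\sum_(1 <= j < k i) num_blocks r k j)
                    * (p%:R ^+ num_blocks r k (k i) - p%:R ^+ i)) :> rat.
  rewrite autE; apply: eq_bigr => i _; rewrite (soc_rank_jordan _ jM).
  by congr (_ ^+ _ * _); apply: eq_bigr => j _; apply: soc_rank_jordan jM.
(* Surjections are either low or high; the high ones number the kernels times the automorphisms of
   [M]. *)
have splitE := card_split_pred (surj_intertwiners (A sigma - 1%:M) (M sigma - 1%:M))
  (fun X => bullet_pow sigma lambda iA *m X <= (M sigma - 1%:M) ^+ lambda)%MS.
rewrite -/(high_intertwiners _ _ _ _) card_high_intertwiners in splitE.
rewrite (count_formula kS jbound (prime_gt1 p_pr) _ (jordan_has_block jM lam_gt0 killM heightM)
  (@soc_rank_anti _ _ (A sigma - 1%:M)) surjE lowE autE' splitE) ?lam_gt0 1?ltnW //.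
have sumA t : \sum_(1 <= j < t) a j
    = \sum_(1 <= j < t) (soc_rank (A sigma - 1%:M) j)%:Z.
  by apply: eq_bigr => j _; rewrite aE.
have sumM t : \sum_(1 <= j < t) m j = \sum_(1 <= j < t) (num_blocks r k j)%:Z.
  by apply: eq_bigr => j _; rewrite mE.
rewrite !mE !aE; congr (_ * _ * _); apply: eq_bigr => i _; first by rewrite !mE aE.
by rewrite sumA sumM !mE.
Qed.
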